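(* Consider the Lagrangian $$\mathcal{L}=\int_{\mathbb{R}}\Big(\tfrac12\big(iu_tu^*-iuu_t^*\big)+h(u,u_x,u^*,u_x^* )\Big)\,\mathrm{d}x ,$$ where the map $h$ satisfies $\left(\frac{\partial h}{\partial u}\right)^*=\frac{\partial h}{\partial u^*}$, and the PDE $$\frac{\partial u}{\partial t}=F(u):=-i\,\frac{\partial}{\partial x}\frac{\partial h}{\partial u_x^*}+i\,\frac{\partial h}{\partial u^*},$$ to which the first variation of the corresponding action functional $\int\mathcal{L}\,\mathrm{d}t$ leads. Let $\hat u(x,\mathbf{q}(t))$ denote a sufficiently smooth ansatz with time-dependent parameters $\mathbf{q}=(q_1,\dots,q_n)$. Define the master equation $$M(\mathbf{q})\,\dot{\mathbf{q}}=\boldsymbol{\xi}(\mathbf{q})+\boldsymbol{\eta}(\mathbf{q}),$$ where $M$ is the metric tensor, with entries $$M_{kj}=\left\langle\frac{\partial\hat u}{\partial q_k},\frac{\partial\hat u}{\partial q_j}\right\rangle_H=\int_{\mathbb{R}}\frac{\partial\hat u}{\partial q_k}\left(\frac{\partial\hat u}{\partial q_j}\right)^*\mathrm{d}x,\qquad k,j=1,\dots,n,$$ and $\boldsymbol{\xi}:\mathbb{C}^n\to\mathbb{C}^n$, $\boldsymbol{\eta}:\mathbb{C}^n\to\mathbb{C}^n$ are vector fields whose entries are $$\xi_k=-i\int_{\mathbb{R}}\frac{\partial\hat u}{\partial q_k}\frac{\partial h}{\partial\hat u}\,\mathrm{d}x,\qquad \eta_k=-i\int_{\mathbb{R}}\frac{\partial\hat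 u_x}{\partial q_k}\frac{\partial h}{\partial\hat u_x}\,\mathrm{d}x,\qquad k=1,\dots,n.$$ Then the following hold: 1. The real part of the master equation coincides with the reduced-order equations produced by RONS. 2. The imaginary part of the master equation coincides with the reduced-order equations produced by the reduced Lagrangian approach.
   Context: Notation: $^*$ denotes complex conjugation. In derivatives of $h$, the variables $u,u^*,u_x,u_x^*$ are treated as independent; $\frac{\partial h}{\partial\hat u}$ and $\frac{\partial h}{\partial\hat u_x}$ denote $\frac{\partial h}{\partial u}$ and $\frac{\partial h}{\partial u_x}$ evaluated at the ansatz $\hat u$. The solution $u$ is complex-valued, with $x\in\mathbb{R}$ and $t\ge 0$. The parameters $\mathbf{q}(t)$ take values in a set $\Omega\subseteq\mathbb{R}^n$, and $\dot{\mathbf{q}}\in\mathbb{R}^n$. The real and imaginary parts of the master equation are $\mathrm{Re}[M]\dot{\mathbf{q}}=\mathrm{Re}[\boldsymbol{\xi}]+\mathrm{Re}[\boldsymbol{\eta}]$ and $\mathrm{Im}[M]\dot{\mathbf{q}}=\mathrm{Im}[\boldsymbol{\xi}]+\mathrm{Im}[\boldsymbol{\eta}]$. Hilbert space: $H$ is the space of complex square-integrable functions on $\mathbb{R}$ with inner product $\langle f,g\rangle_H=\int_{\mathbb{R}}f\,g^*\,\mathrm{d}x$ and norm $\|\cdot\|_H$; the ansatz maps parameters to elements $\hat u(\cdot,\mathbf{q})$ of $H$. The metric tensor $M\in\mathbb{C}^{n\times n}$ is Hermitian positive definite. RONS (reduced-order nonlinear solutions), without enforced conserved quantities: for given $\mathbf{q}$,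 $\dot{\mathbf{q}}$ is chosen to minimize the instantaneous error $\mathcal{J}(\mathbf{q},\dot{\mathbf{q}})=\frac12\|\hat u_t-F(\hat u)\|_H^2$ over $\dot{\mathbf{q}}\in\mathbb{R}^n$, where $\hat u_t=\sum_{j=1}^n\frac{\partial\hat u}{\partial q_j}\dot q_j$. The resulting reduced-order equation is $\dot{\mathbf{q}}=(\mathrm{Re}[M])^{-1}\mathrm{Re}[\mathbf{f}]$, where $f_k=\langle\frac{\partial\hat u}{\partial q_k},F(\hat u)\rangle_H$. Reduced Lagrangian approach: substitute the ansatz $\hat u(x,\mathbf{q}(t))$ into $\mathcal{L}$ and integrate over $x$ to obtain the reduced Lagrangian $\hat{\mathcal{L}}(\mathbf{q},\dot{\mathbf{q}})$. The reduced-order equations are the classical Euler--Lagrange equations $\frac{\partial\hat{\mathcal{L}}}{\partial q_k}-\frac{\mathrm{d}}{\mathrm{d}t}\frac{\partial\hat{\mathcal{L}}}{\partial\dot q_k}=0$, $k=1,\dots,n$. ''Coincides'' means equality as systems of equations for $\dot{\mathbf{q}}$ (up to equivalent rewriting, such as multiplying by a nonzero constant).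
   Formalization: Stationarity of the action in u and u^* is assumed equivalent to the PDE (automatic for real h): with only (h_u)^*=h_{u^*}, h=i|u_x|^2 breaks claim 1. ''Sufficiently smooth'' is spelled out: h and ansatz C^2, Ω open, local domination, integrability, vanishing boundary terms. *)

(* Defs.v *)
From HB Require Import structures.
From mathcomp Require Import all_boot all_order all_algebra.
From mathcomp Require Import complex.
From mathcomp Require Import all_classical all_reals all_analysis.

Set Implicit Arguments.
Unset Strict Implicit.
Unset Printing Implicit Defensive.

Import Order.TTheory GRing.Theory Num.Theory.
Import numFieldNormedType.Exports.

Local Open Scope classical_set_scope.
Local Open Scope complex_scope.
Local Open Scope ring_scope.

Section ComplexCalculus.
Context {R : realType}.

(* Derivatives of complex-valued maps on a real normed space are taken
   componentwise. *)
Definition cderivable (V : normedModType R) (v : V) (f : V -> R[i]) (a : V) :=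
  derivable (fun y => complex.Re (f y)) a v /\
  derivable (fun y => complex.Im (f y)) a v.

Definition cD (V : normedModType R) (v : V) (f : V -> R[i]) (a : V) : R[i] :=
  'D_v (fun y => complex.Re (f y)) a +i* 'D_v (fun y => complex.Im (f y)) a.

Definition dd (f : R -> R[i]) (a : R) : R[i] := cD (1 : R) f a.

(* The set A is meant to be open; V is finite-dimensional in all uses. *)
Fixpoint Ck (k : nat) (V : normedModType R) (A : set V) (f : V -> R) : Prop :=
  match k with
  | 0%N => forall a, A a -> {for a, continuous f}
  | k'.+1 => (forall a, A a -> differentiable f a) /\
             (forall v, Ck k' A (fun a => 'D_v f a))
  end.

Definition cCk (k : nat) (V : normedModType R) (A : set V) (f : V -> R[i]) :=
  Ck k A (fun a => complex.Re (f a)) /\ Ck k A (fun a => complex.Im (f a)).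

(* Wirtinger derivatives: this is the meaning of "u and u^* are treated as
   independent" for a map that need not be holomorphic. *)
Definition wirtinger (g : R[i] -> R[i]) (z : R[i]) : R[i] :=
  2^-1 * (dd (fun a => g (a +i* complex.Im z)) (complex.Re z)
          - 'i%C * dd (fun b => g (complex.Re z +i* b)) (complex.Im z)).

Definition wirtinger_conj (g : R[i] -> R[i]) (z : R[i]) : R[i] :=
  2^-1 * (dd (fun a => g (a +i* complex.Im z)) (complex.Re z)
          + 'i%C * dd (fun b => g (complex.Re z +i* b)) (complex.Im z)).

Local Notation mu := (@lebesgue_measure R).

Definition cintegrable (f : R -> R[i]) : Prop :=
  mu.-integrable setT (EFin \o (fun x => complex.Re (f x))) /\
  mu.-integrable setT (EFin \o (fun x => complex.Im (f x))).

Definition cint (f : R -> R[i]) : R[i] :=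
  (\int[mu]_x complex.Re (f x)) +i* (\int[mu]_x complex.Im (f x)).

Definition inH (f : R -> R[i]) : Prop :=
  (fun x => complex.Re (f x)) \in Lfun mu 2%:E /\
  (fun x => complex.Im (f x)) \in Lfun mu 2%:E.

Definition inner (f g : R -> R[i]) : R[i] := cint (fun x => f x * (g x)^*).

Definition normH (f : R -> R[i]) : R := Num.sqrt (complex.Re (inner f f)).

End ComplexCalculus.

Section Lagrangian.
Context {R : realType}.

(* h u p stands for h(u, u_x, u^*, u_x^* ) with p = u_x; the conjugates are
   determined by u and p. *)
Variable h : R[i] -> R[i] -> R[i].

Definition h_u (u p : R[i]) : R[i] := wirtinger (fun z => h z p) u.
Definition h_ubar (u p : R[i]) : R[i] := wirtinger_conj (fun z => h z p) u.
Definition h_ux (u p : R[i]) : R[i] := wirtinger (h u) p.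
Definition h_uxbar (u p : R[i]) : R[i] := wirtinger_conj (h u) p.

Definition C2_map : Prop :=
  cCk 2 setT (fun z : (R * R) * (R * R) =>
                h (z.1.1 +i* z.1.2) (z.2.1 +i* z.2.2)).

(* Arguments: the values of u, u_t and u_x. *)
Definition lagr_density (u ut ux : R[i]) : R[i] :=
  2^-1 * ('i%C * ut * u^* - 'i%C * u * ut^*) + h u ux.

Definition pde_rhs (w : R -> R[i]) (x : R) : R[i] :=
  - 'i%C * dd (fun y => h_uxbar (w y) (dd w y)) x + 'i%C * h_ubar (w x) (dd w x).

Definition dt (u : R -> R -> R[i]) (t x : R) : R[i] := dd (fun s => u s x) t.
Definition dx (u : R -> R -> R[i]) (t x : R) : R[i] := dd (u t) x.

(* The two densities of the first variation of the action, for variations of u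
   and of u^* taken as independent; the first argument of u is the time. *)
Definition var_u (u : R -> R -> R[i]) (t x : R) : R[i] :=
  wirtinger (fun z => lagr_density z (dt u t x) (dx u t x)) (u t x)
  - dd (fun s =>
      wirtinger (fun z => lagr_density (u s x) z (dx u s x)) (dt u s x)) t
  - dd (fun y =>
      wirtinger (fun z => lagr_density (u t y) (dt u t y) z) (dx u t y)) x.

Definition var_ubar (u : R -> R -> R[i]) (t x : R) : R[i] :=
  wirtinger_conj (fun z => lagr_density z (dt u t x) (dx u t x)) (u t x)
  - dd (fun s =>
      wirtinger_conj (fun z => lagr_density (u s x) z (dx u s x)) (dt u s x)) t
  - dd (fun y =>
      wirtinger_conj (fun z => lagr_density (u t y) (dt u t y) z) (dx u t y)) x.

(* Pointwise in (t, x). For h of class C^2, var_ubar = 0 is always the PDE; that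
   var_u = 0 be the same PDE is what links h_ux with h_uxbar. It holds for
   every real-valued h, and fails e.g. for h = i |u_x|^2, although there
   (h_u)^* = h_ubar. *)
Definition first_variation_leads_to_pde : Prop :=
  forall u : R -> R -> R[i],
  cCk 2 setT (fun z : R * R => u z.1 z.2) ->
  forall t x, (var_u u t x = 0 /\ var_ubar u t x = 0) <->
              dt u t x = pde_rhs (u t) x.

End Lagrangian.

Section Reduction.
Context {R : realType} {n : nat}.
Variable h : R[i] -> R[i] -> R[i].
Variable uhat : 'cV[R]_n -> R -> R[i].

Definition basis (k : 'I_n) : 'cV[R]_n := delta_mx k 0.

Definition dq (k : 'I_n) (W : 'cV[R]_n -> R -> R[i]) (q : 'cV[R]_n) (x : R)
  : R[i] := cD (basis k) (fun p => W p x) q.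

Definition uhat_x (q : 'cV[R]_n) (x : R) : R[i] := dd (uhat q) x.

Definition metric (q : 'cV[R]_n) : 'M[R[i]]_n :=
  \matrix_(k, j) inner (dq k uhat q) (dq j uhat q).

Definition xi (q : 'cV[R]_n) : 'cV[R[i]]_n :=
  \col_k (- 'i%C * cint (fun x => dq k uhat q x * h_u h (uhat q x) (uhat_x q x))).

Definition eta (q : 'cV[R]_n) : 'cV[R[i]]_n :=
  \col_k (- 'i%C * cint (fun x => dq k uhat_x q x * h_ux h (uhat q x) (uhat_x q x))).

Definition Remx (m p : nat) (A : 'M[R[i]]_(m, p)) : 'M[R]_(m, p) :=
  map_mx (@complex.Re R) A.
Definition Immx (m p : nat) (A : 'M[R[i]]_(m, p)) : 'M[R]_(m, p) :=
  map_mx (@complex.Im R) A.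

Definition master_Re (q v : 'cV[R]_n) : Prop :=
  Remx (metric q) *m v = Remx (xi q) + Remx (eta q).

Definition master_Im (q v : 'cV[R]_n) : Prop :=
  Immx (metric q) *m v = Immx (xi q) + Immx (eta q).

Definition hermitian_posdef (A : 'M[R[i]]_n) : Prop :=
  (forall k j, A k j = (A j k)^*) /\
  (forall z : 'cV[R[i]]_n, z != 0 ->
     0 < \sum_k \sum_j (z k 0)^* * A k j * z j 0).

Definition uhat_t (q v : 'cV[R]_n) (x : R) : R[i] :=
  \sum_j dq j uhat q x * (v j 0)%:C.

Definition rons_error (q v : 'cV[R]_n) : R :=
  2^-1 * normH (fun x => uhat_t q v x - pde_rhs h (uhat q) x) ^+ 2.

Definition rons_minimizer (q v : 'cV[R]_n) : Prop :=
  forall w : 'cV[R]_n, rons_error q v <= rons_error q w.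

Definition rons_f (q : 'cV[R]_n) : 'cV[R[i]]_n :=
  \col_k inner (dq k uhat q) (pde_rhs h (uhat q)).

Definition rons_equation (q v : 'cV[R]_n) : Prop :=
  v = invmx (Remx (metric q)) *m Remx (rons_f q).

Definition reduced_lagrangian (q v : 'cV[R]_n) : R[i] :=
  cint (fun x => lagr_density h (uhat q x) (uhat_t q v x) (uhat_x q x)).

(* The partial derivative in qdot_k, along a trajectory. *)
Definition momentum (k : 'I_n) (q : R -> 'cV[R]_n) (s : R) : R[i] :=
  cD (basis k) (reduced_lagrangian (q s)) (derive1 q s).

(* The equations include the existence of the derivatives they mention. *)
Definition reduced_euler_lagrange (q : R -> 'cV[R]_n) (t : R) : Prop :=
  forall k : 'I_n,
  [/\ cderivable (basis k) (fun p => reduced_lagrangian p (derive1 q t)) (q t),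
      \forall s \near t,
        cderivable (basis k) (reduced_lagrangian (q s)) (derive1 q s),
      cderivable (1 : R) (momentum k q) t &
      cD (basis k) (fun p => reduced_lagrangian p (derive1 q t)) (q t)
      - dd (momentum k q) t = 0].

(* "Sufficiently smooth": joint C^2 regularity, the integrals of the theory
   exist, may be differentiated in q (local domination), and the boundary
   terms of the integration by parts in x vanish. *)
Record sufficiently_smooth (Omega : set 'cV[R]_n) : Prop := SufficientlySmooth {
  smooth_C2 : cCk 2 [set z : R * 'cV[R]_n | Omega z.2] (fun z => uhat z.2 z.1) ;
  smooth_inH : forall q, Omega q -> inH (uhat q) ;
  smooth_rhs_inH : forall q, Omega q -> inH (pde_rhs h (uhat q)) ;
  smooth_dominated : forall q0, Omega q0 ->
    exists2 G : R -> R, G \in Lfun (@lebesgue_measure R) 2%:E &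
      \forall q \near q0, forall x,
        [/\ `|uhat q x| <= (G x)%:C,
            forall k, `|dq k uhat q x| <= (G x)%:C &
            forall k j, `|dq j (dq k uhat) q x| <= (G x)%:C] ;
  smooth_h_integrable : forall q, Omega q ->
    cintegrable (fun x => h (uhat q x) (uhat_x q x)) ;
  smooth_h_dominated : forall q0, Omega q0 ->
    exists2 g : R -> R, (@lebesgue_measure R).-integrable setT (EFin \o g) &
      \forall q \near q0, forall x k,
        `|dq k (fun p y => h (uhat p y) (uhat_x p y)) q x| <= (g x)%:C ;
  smooth_xi_integrable : forall q k, Omega q ->
    cintegrable (fun x => dq k uhat q x * h_u h (uhat q x) (uhat_x q x)) ;
  smooth_eta_integrable : forall q k, Omega q ->
    cintegrable (fun x => dq k uhat_x q x * h_ux h (uhat q x) (uhat_x q x)) ;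
  smooth_boundary : forall q k, Omega q ->
    let b x := complex.Re `|dq k uhat q x * h_ux h (uhat q x) (uhat_x q x)| in
    b x @[x --> +oo] --> (0 : R) /\ b x @[x --> -oo] --> (0 : R) }.

End Reduction.

(* Main.v *)
Require Import Defs.
From mathcomp Require Import all_boot all_order all_algebra.
From mathcomp Require Import complex.
From mathcomp Require Import all_classical all_reals all_analysis.
From mathcomp Require Import measurable_realfun.
From mathcomp Require Import ring lra.

Import Order.TTheory GRing.Theory Num.Theory.
Import numFieldNormedType.Exports.

Local Open Scope classical_set_scope.
Local Open Scope complex_scope.
Local Open Scope ring_scope.

Set Implicit Arguments.
Unset Strict Implicit.
Unset Printing Implicit Defensive.

(** Write u for the ansatz, u_k for its derivative in q_k, F for the right-hand
    side of the PDE, p for the slot of u_x, and h_p, h_pbar for the two Wirtinger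
    derivatives of h in that slot.  Two integral identities carry the proof.

    Real part.  Conjugating the PDE gives F^* = i (h_p)_x - i h_u along the ansatz,
    hence u_k F^* = - i (u_k h_u + u_kx h_p - (u_k h_p)_x).  The last term is a
    total derivative whose integral vanishes, because of the boundary condition,
    so that f = xi + eta as complex vectors (rons_fE).  The error is a quadratic
    polynomial of the velocity: J(v + d) is J(v) + d . (Re M v - Re f) plus half
    the squared norm of sum_j d_j u_j (rons_error_expand).  Thus v is a minimizer
    iff Re M v = Re f, and Re M is invertible because M is Hermitian positive
    definite.

    Imaginary part.  The reduced Lagrangian is affine in the velocity,
    sum_j v_j P_j(q) + int h, with P_j = - Im <u_j, u> (reduced_lagrangianE).  So
    only the curl of P and the gradient of int h enter the Euler-Lagrange
    equations.  In d_k P_j - d_j P_k the second derivatives of u cancel, and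
    2 Im M_kj remains (curl_canonical_momentum); the derivative of int h in q_k is
    twice the real part of int u_k h_u + int u_kx h_p (cint_dq_h_along), which is
    - 2 Im (xi_k + eta_k).  The k-th Euler-Lagrange equation is therefore twice
    the k-th row of the imaginary part.

    The map h need not be real-valued: (h_u)^* = h_ubar says nothing about h_p and
    h_pbar.  These are linked by the hypothesis that the first variation leads to
    the PDE.  Tested on u(t, x) = w(x) + t F(w)(x0), which solves the PDE at the
    point (0, x0), it yields (h_p)_x = ((h_pbar)_x)^* along any w of class
    C^2 (conj_dd_h_ux).  This is what the real part needs.  In the imaginary part,
    h_pbar - (h_p)^* is then a constant in x, and it contributes this constant
    times the integral of (u_kx)^*, which vanishes since u_k is square-integrable
    (h_uxbar_defect, integral_derive_eq0).

    Two analytic facts are established on the way: the symmetry of second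
    derivatives (Ck2_derive_comm), and differentiation under the integral along a
    curve of which only the differentiability at one point is used
    (derive_under_integral), which suits a trajectory whose velocity need not be
    bounded near t. *)

(** * Directional derivatives and the symmetry of second derivatives *)

Section Lines.
Context {R : realType}.
Implicit Types V W : normedModType R.

(** Holds without any differentiability: both sides are limits of the same
    difference quotients.  It identifies partial derivatives, derivatives along
    lines and directional derivatives with one another. *)
Lemma same_growth V V' W (f : V -> W) (g : V' -> W) (a v : V) (b w : V') :
  (forall r : R, f (a + r *: v) = g (b + r *: w)) ->
  'D_v f a = 'D_w g b /\ (derivable f a v <-> derivable g b w).
Proof.
move=> fg; have fg0 : f a = g b by have := fg 0; rewrite !scale0r !addr0.
have e : (fun r : R => r^-1 *: ((f \o shift a) (r *: v) - f a)) =
         (fun r : R => r^-1 *: ((g \o shift b) (r *: w) - g b)).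
  by apply/funext => r /=; rewrite [r *: v + a]addrC fg fg0 [b + _]addrC.
by rewrite /derive /derivable e.
Qed.

Lemma is_derive_along_line V W (f : V -> W) (a v : V) (s : R) :
  derivable f (a + s *: v) v ->
  is_derive s 1 (fun r : R => f (a + r *: v)) ('D_v f (a + s *: v)).
Proof.
have [|e1 e2] := @same_growth _ _ _ f (fun r : R => f (a + r *: v))
    (a + s *: v) v s 1.
  by move=> r; rewrite [r *: 1]mulr1 scalerDl addrA.
by move=> df; rewrite e1; apply: DeriveDef => //; apply/e2.
Qed.

Lemma derive_fst V V' W (f : V * V' -> W) (v x : V) (q : V') :
  'D_(v, 0) f (x, q) = 'D_v (fun y => f (y, q)) x.
Proof.
apply: (same_growth _).1 => r.
by rewrite -[_ + r *: (v, 0)]/(x + r *: v, q + r *: 0) scaler0 addr0.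
Qed.

Lemma derive_snd V V' W (f : V * V' -> W) (v q : V') (x : V) :
  'D_(0, v) f (x, q) = 'D_v (fun y => f (x, y)) q.
Proof.
apply: (same_growth _).1 => r.
by rewrite -[_ + r *: (0, v)]/(x + r *: 0, q + r *: v) scaler0 addr0.
Qed.

Lemma derive_comp V V' W (f : V -> V') (g : V' -> W) (a v : V) :
  differentiable f a -> differentiable g (f a) ->
  'D_v (g \o f) a = 'D_('D_v f a) g (f a).
Proof.
move=> df dg; rewrite !deriveE//; last exact: differentiable_comp.
by rewrite diff_comp.
Qed.

(** The mean value theorem, used first in the direction v and then in the
    direction w.  The second difference is symmetric in v and w, which is how the
    symmetry of second derivatives arises. *)
Lemma second_difference V (f : V -> R) (A : set V) (a v w : V) (t : R) :
  0 < t ->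
  (forall r s, r \in `[0, t] -> s \in `[0, t] -> A (a + r *: v + s *: w)) ->
  (forall p, A p -> derivable f p v) ->
  (forall p, A p -> derivable (fun y => 'D_v f y) p w) ->
  exists r s, [/\ r \in `[0, t], s \in `[0, t] &
    f (a + t *: v + t *: w) - f (a + t *: v) - f (a + t *: w) + f a
    = t ^+ 2 * 'D_w (fun y => 'D_v f y) (a + r *: v + s *: w)].
Proof.
move=> t0 inA df ddf.
have t00 : (0 : R) \in `[0, t] by rewrite in_itv/= lexx ltW.
have tt : t \in `[0, t] by rewrite in_itv/= lexx ltW.
pose F r := f (a + t *: w + r *: v) - f (a + r *: v).
have dF r : r \in `[0, t] ->
    is_derive r 1 F ('D_v f (a + t *: w + r *: v) - 'D_v f (a + r *: v)).
  move=> rt; apply: is_deriveB.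
    by apply: is_derive_along_line; apply: df; rewrite addrAC; exact: inA.
  apply: is_derive_along_line; apply: df.
  by have := inA r 0 rt t00; rewrite scale0r addr0.
have cF : {within `[0, t], continuous F}.
  by apply: derivable_within_continuous => r rt; have [] := dF r rt.
have [r rt Fr] := MVT t0 (fun r rt => dF r (subset_itv_oo_cc rt)) cF.
have {}rt := subset_itv_oo_cc rt.
pose G s := 'D_v f (a + r *: v + s *: w).
have dG s : s \in `[0, t] ->
    is_derive s 1 G ('D_w (fun y => 'D_v f y) (a + r *: v + s *: w)).
  by move=> st; apply: is_derive_along_line; apply: ddf; exact: inA.
have cG : {within `[0, t], continuous G}.
  by apply: derivable_within_continuous => s st; have [] := dG s st.
have [s st Gs] := MVT t0 (fun s st => dG s (subset_itv_oo_cc st)) cG.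
exists r, s; split => //; first exact: subset_itv_oo_cc.
have -> : f (a + t *: v + t *: w) - f (a + t *: v) - f (a + t *: w) + f a =
    F t - F 0.
  by rewrite /F !scale0r !addr0 [a + t *: w + t *: v]addrAC opprB addrA [LHS]addrAC.
have e : 'D_v f (a + t *: w + r *: v) - 'D_v f (a + r *: v) = G t - G 0.
  by rewrite /G scale0r addr0 [a + t *: w + r *: v]addrAC.
by rewrite Fr e Gs; ring.
Qed.

Lemma continuous2_ball V (A : set V) (a : V) (p q : V -> R) (e : R) :
  open A -> A a -> {for a, continuous p} -> {for a, continuous q} -> 0 < e ->
  exists2 d : R, 0 < d & forall y, ball a d y ->
    [/\ A y, `|p a - p y| < e & `|q a - q y| < e].
Proof.
move=> oA Aa cp cq e0.
have /nbhs_ballP[d d0 H] : \forall y \near a,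
    [/\ A y, `|p a - p y| < e & `|q a - q y| < e].
  near=> y; split; near: y.
  - exact: open_nbhs_nbhs.
  - by move/cvgrPdist_lt : cp; exact.
  - by move/cvgrPdist_lt : cq; exact.
by exists d.
Unshelve. all: by end_near. Qed.

Lemma dist_le_of_halves (x y z e : R) :
  `|x - z| < e / 2 -> `|y - z| < e / 2 -> `|x - y| <= e.
Proof.
rewrite (distrC y) => xz yz; rewrite (le_trans (ler_distD z _ _))//.
by rewrite [leRHS]splitr lerD// ltW.
Qed.

(** Symmetry of second derivatives.  Both mixed derivatives, taken at two
    possibly different points close to a, equal the same second difference divided
    by t^2; they are continuous at a. *)
Lemma Ck2_derive_comm V (A : set V) (f : V -> R) (a v w : V) :
  open A -> Ck 2 A f -> A a ->
  'D_w (fun y => 'D_v f y) a = 'D_v (fun y => 'D_w f y) a.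
Proof.
move=> oA [df ddf] Aa; apply/eqP; rewrite -subr_eq0 -normr_le0.
apply/ler_addgt0Pl => e e0; rewrite addr0.
have e2 : 0 < e / 2 by rewrite divr_gt0.
have c1 := (ddf v).2 w a Aa; have c2 := (ddf w).2 v a Aa.
have [d d0 H] := continuous2_ball oA Aa c1 c2 e2.
(* The step t keeps the parallelogram spanned by t v and t w inside the ball;
   the summand 1 covers v = w = 0. *)
pose N := `|v| + `|w| + 1.
have N0 : 0 < N by rewrite ltr_wpDl// addr_ge0.
pose t := d / N.
have t0 : 0 < t by rewrite divr_gt0.
have inball x y r s : (x, y) = (v, w) \/ (x, y) = (w, v) ->
    r \in `[0, t] -> s \in `[0, t] -> ball a d (a + r *: x + s *: y).
  move=> xy; rewrite !in_itv/= => /andP[r0 rt] /andP[s0 st].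
  rewrite -ball_normE /= opprD addrA opprD addrA subrr sub0r -opprD normrN.
  rewrite (le_lt_trans (ler_normD _ _))// !normrZ (ger0_norm r0) (ger0_norm s0).
  have : r * `|x| + s * `|y| <= t * (`|v| + `|w|).
    have : r * `|x| <= t * `|x| by rewrite ler_wpM2r.
    have : s * `|y| <= t * `|y| by rewrite ler_wpM2r.
    by case: xy => -[-> ->]; lra.
  move=> /le_lt_trans; apply; rewrite /t mulrAC ltr_pdivrMr// ltr_pM2l//.
  by rewrite /N ltrDl.
have df' x p : A p -> derivable f p x by move=> /df; exact: diff_derivable.
have ddf' x y p : A p -> derivable (fun z => 'D_x f z) p y.
  by move=> /((ddf x).1 p) h; exact: diff_derivable.
have [||r [s [rt st E1]]] := @second_difference _ f A a v w t t0 _ (df' v).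
- by move=> r s rt st; have [] := H _ (inball v w r s (or_introl erefl) rt st).
- exact: ddf'.
have [||r' [s' [rt' st' E2]]] := @second_difference _ f A a w v t t0 _ (df' w).
- by move=> r' s' rt' st'; have [] := H _ (inball w v r' s' (or_intror erefl) rt' st').
- exact: ddf'.
have [_ h1 _] := H _ (inball v w r s (or_introl erefl) rt st).
have [_ _ h2] := H _ (inball w v r' s' (or_intror erefl) rt' st').
have symE (x y z u : R) : x - y - z + u = x - z - y + u by rewrite (addrAC x).
have t20 : t ^+ 2 != 0 by rewrite expf_neq0// gt_eqF.
rewrite (addrAC a) symE in E2.
have E := mulfI t20 (etrans (esym E1) E2).
rewrite -E in h2.
exact: dist_le_of_halves h1 h2.
Qed.
End Lines.

(** * Calculus of C^k functions *)

Section Ck_calculus.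
Context {R : realType}.
Implicit Types V W : normedModType R.

Lemma Ck1_continuous V (A : set V) (f : V -> R) (a : V) :
  Ck 1 A f -> A a -> {for a, continuous f}.
Proof. by move=> [df _] /df /differentiable_continuous. Qed.

Lemma Ck2_Ck1 V (A : set V) (f : V -> R) : Ck 2 A f -> Ck 1 A f.
Proof.
move=> [df ddf]; split=> // v a Aa.
exact: Ck1_continuous (ddf v) Aa.
Qed.

(** An affine map L with linear part L0 transports the derivative in the
    direction v to the one in the direction L0 v at every point, with no
    differentiability needed, so the induction on k goes through for plain functions. *)
Lemma Ck_affine_comp V W (L : W -> V) (L0 : W -> V) (k : nat) (A : set V)
    (f : V -> R) :
  (forall z, differentiable L z) ->
  (forall z w (r : R), L (z + r *: w) = L z + r *: L0 w) ->
  Ck k A f -> Ck k (L @^-1` A) (f \o L).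
Proof.
move=> dL LE; elim: k f => [|k IH] f /=.
  move=> cf z Az; apply: continuous_comp; last exact: cf.
  exact: differentiable_continuous.
move=> [df ddf]; split=> [z Az|v].
  by apply: differentiable_comp => //; exact: df.
have -> : (fun a => 'D_v (f \o L) a) = (fun a => 'D_(L0 v) f a) \o L.
  by apply/funext => z /=; apply: (same_growth _).1 => r /=; rewrite LE.
exact: IH.
Qed.

Lemma Ck_cst V (k : nat) (c : R) : Ck k [set: V] (fun _ : V => c).
Proof.
elim: k c => [|k IH] c /=; first by move=> a _; exact: cst_continuous.
split=> [a _|v]; first exact: differentiable_cst.
have -> : (fun a : V => 'D_v (fun _ : V => c) a) = (fun _ => 0) :> (V -> R).
  by apply/funext => a; rewrite derive_cst.
exact: IH.
Qed.

Lemma CkD V (k : nat) (f g : V -> R) :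
  Ck k [set: V] f -> Ck k [set: V] g -> Ck k [set: V] (fun z => f z + g z).
Proof.
elim: k f g => [|k IH] f g /=.
  by move=> cf cg a _; apply: cvgD; [exact: cf|exact: cg].
move=> [df ddf] [dg ddg]; split=> [a _|v].
  by apply: differentiableD; [exact: df|exact: dg].
have -> : (fun a : V => 'D_v (fun z => f z + g z) a) =
          (fun a => 'D_v f a + 'D_v g a).
  apply/funext => a; rewrite deriveD//.
    by apply: diff_derivable; exact: df.
  by apply: diff_derivable; exact: dg.
exact: IH.
Qed.

Lemma Ck1M V (f g : V -> R) :
  Ck 1 [set: V] f -> Ck 1 [set: V] g -> Ck 1 [set: V] (fun z => f z * g z).
Proof.
move=> f1 g1; have [df ddf] := f1; have [dg ddg] := g1; split=> [a _|v].
  by apply: differentiableM; [exact: df|exact: dg].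
have -> : (fun a : V => 'D_v (fun z => f z * g z) a) =
          (fun a => f a * 'D_v g a + g a * 'D_v f a).
  apply/funext => a; rewrite deriveM//.
    by apply: diff_derivable; exact: df.
  by apply: diff_derivable; exact: dg.
move=> a _; apply: cvgD; apply: cvgM.
- exact: (Ck1_continuous f1).
- exact: ddg.
- exact: (Ck1_continuous g1).
- exact: ddf.
Qed.

Lemma CkZ V (k : nat) (c : R) (f : V -> R) :
  Ck k [set: V] f -> Ck k [set: V] (fun z => c * f z).
Proof.
elim: k f => [|k IH] f /=.
  by move=> cf a _; apply: cvgM; [exact: cvg_cst|exact: cf].
move=> [df ddf]; split=> [a _|v].
  by apply: differentiableM; [exact: differentiable_cst|exact: df].
have -> : (fun a : V => 'D_v (fun z => c * f z) a) = (fun a => c * 'D_v f a).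
  apply/funext => a; rewrite -[RHS]/(c *: _) -deriveZ//.
  by apply: diff_derivable; exact: df.
exact: IH.
Qed.

Lemma derive_pair V W (W' : normedModType R) (f : V -> W) (g : V -> W') (a v : V) :
  differentiable f a -> differentiable g a ->
  'D_v (fun y => (f y, g y)) a = ('D_v f a, 'D_v g a).
Proof.
move=> df dg; rewrite (deriveE _ (differentiable_pair df dg)) !deriveE//.
by rewrite diff_pair.
Qed.

(** The shape u v - s t is that of the momentum density. *)
Lemma derive_cross (W : normedModType R) (u v s t : W -> R) (a d : W) :
  differentiable u a -> differentiable v a -> differentiable s a ->
  differentiable t a ->
  differentiable (fun y => u y * v y - s y * t y) a /\
  'D_d (fun y => u y * v y - s y * t y) a =
  u a * 'D_d v a + v a * 'D_d u a - (s a * 'D_d t a + t a * 'D_d s a).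
Proof.
move=> du dv ds dt; split.
  by apply: differentiableB; exact: differentiableM.
have du' : derivable u a d by exact: diff_derivable.
have dv' : derivable v a d by exact: diff_derivable.
have ds' : derivable s a d by exact: diff_derivable.
have dt' : derivable t a d by exact: diff_derivable.
have := deriveB (derivableM du' dv') (derivableM ds' dt').
by rewrite (deriveM du' dv') (deriveM ds' dt').
Qed.

Definition axis1 : (R * R) * (R * R) := ((1, 0), (0, 0)).
Definition axis2 : (R * R) * (R * R) := ((0, 1), (0, 0)).
Definition axis3 : (R * R) * (R * R) := ((0, 0), (1, 0)).
Definition axis4 : (R * R) * (R * R) := ((0, 0), (0, 1)).

Lemma derive_linear V W (f : V -> W) (a : V) (v w : V) (r : R) :
  differentiable f a -> 'D_(r *: v + w) f a = r *: 'D_v f a + 'D_w f a.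
Proof. by move=> df; rewrite !deriveE// linearP. Qed.

Lemma derive_scale V W (f : V -> W) (a v : V) (r : R) :
  differentiable f a -> 'D_(r *: v) f a = r *: 'D_v f a.
Proof. by move=> df; rewrite !deriveE// linearZ. Qed.

Lemma derive_coord4 (H : (R * R) * (R * R) -> R) p (r s t u : R) :
  differentiable H p ->
  'D_((r, s), (t, u)) H p =
  r * 'D_axis1 H p + s * 'D_axis2 H p + t * 'D_axis3 H p + u * 'D_axis4 H p.
Proof.
move=> dH.
have -> : ((r, s), (t, u)) = r *: axis1 + (s *: axis2 + (t *: axis3 + u *: axis4)).
  congr ((_, _), (_, _));
    by rewrite /= /GRing.scale /= !(mulr0, mulr1, addr0, add0r).
rewrite (derive_linear _ _ r dH) (derive_linear _ _ s dH).
rewrite (derive_linear _ _ t dH) (derive_scale _ u dH).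
move: ('D_axis1 H p) ('D_axis2 H p) ('D_axis3 H p) ('D_axis4 H p) => x y z w.
by rewrite !addrA.
Qed.

Section Composition4.
Context {V : normedModType R}.
Variables (H : (R * R) * (R * R) -> R) (u1 u2 u3 u4 : V -> R).
Let P y := ((u1 y, u2 y), (u3 y, u4 y)).

Lemma differentiable_point4 (a : V) :
  differentiable u1 a -> differentiable u2 a -> differentiable u3 a ->
  differentiable u4 a -> differentiable P a.
Proof.
by move=> *; apply: differentiable_pair; apply: differentiable_pair.
Qed.

(** Meant for the parts of h, seen as functions of the four real variables
    (Re u, Im u), (Re u_x, Im u_x). *)
Lemma derive_comp4 (a v : V) :
  differentiable u1 a -> differentiable u2 a -> differentiable u3 a ->
  differentiable u4 a -> differentiable H (P a) ->
  'D_v (fun y => H (P y)) a =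
  'D_v u1 a * 'D_axis1 H (P a) + 'D_v u2 a * 'D_axis2 H (P a)
  + 'D_v u3 a * 'D_axis3 H (P a) + 'D_v u4 a * 'D_axis4 H (P a).
Proof.
move=> d1 d2 d3 d4 dH.
rewrite (derive_comp _ (differentiable_point4 d1 d2 d3 d4) dH).
have -> : 'D_v P a = (('D_v u1 a, 'D_v u2 a), ('D_v u3 a, 'D_v u4 a)).
  rewrite /P (derive_pair v (differentiable_pair d1 d2) (differentiable_pair d3 d4)).
  by rewrite (derive_pair v d1 d2) (derive_pair v d3 d4).
exact: derive_coord4.
Qed.

Lemma Ck1_comp4 : Ck 1 setT H -> Ck 1 setT u1 -> Ck 1 setT u2 ->
  Ck 1 setT u3 -> Ck 1 setT u4 -> Ck 1 setT (fun y => H (P y)).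
Proof.
move=> [dH ddH] [d1 dd1] [d2 dd2] [d3 dd3] [d4 dd4].
have dP a : differentiable P a.
  by apply: differentiable_point4; [exact: d1|exact: d2|exact: d3|exact: d4].
split=> [a _|v].
  by apply: (@differentiable_comp _ _ _ _ P H) => //; exact: dH.
have -> : (fun a => 'D_v (fun y => H (P y)) a) = (fun a =>
  'D_v u1 a * 'D_axis1 H (P a) + 'D_v u2 a * 'D_axis2 H (P a)
  + 'D_v u3 a * 'D_axis3 H (P a) + 'D_v u4 a * 'D_axis4 H (P a)).
  by apply/funext => a; rewrite derive_comp4//;
    [exact: d1|exact: d2|exact: d3|exact: d4|exact: dH].
have cH e a : {for a, continuous (fun y => 'D_e H (P y))}.
  apply: (@continuous_comp _ _ _ P (fun p => 'D_e H p)); last exact: ddH.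
  exact: differentiable_continuous.
have cM (u : V -> R) e a : {for a, continuous (fun y => 'D_v u y)} ->
    {for a, continuous (fun y => 'D_v u y * 'D_e H (P y))}.
  by move=> cu; apply: cvgM => //; exact: cH.
move=> a _; have c1 := cM u1 axis1 a (dd1 v a I); have c2 := cM u2 axis2 a (dd2 v a I).
have c3 := cM u3 axis3 a (dd3 v a I); have c4 := cM u4 axis4 a (dd4 v a I).
exact: (cvgD (cvgD (cvgD c1 c2) c3) c4).
Qed.

End Composition4.
End Ck_calculus.

(** * Square-integrable functions and integrals of derivatives over the line *)

Section Integrals.
Context {R : realType}.
Local Notation mu := (@lebesgue_measure R).
Local Notation integ f := (mu.-integrable setT (EFin \o f)).
Implicit Types f g G : R -> R.

Lemma dominated_Lfun2 f G : measurable_fun setT f ->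
  (forall x, `|f x| <= G x) -> G \in Lfun mu 2%:E -> f \in Lfun mu 2%:E.
Proof.
move=> mf fG; rewrite !inE => /andP[/[!inE]/= mG lG].
apply/andP; split; rewrite inE//= /finite_norm.
apply: le_lt_trans lG; rewrite unlock gt0_ler_poweR//.
- by rewrite in_itv/= leey integral_ge0.
- by rewrite in_itv/= leey integral_ge0.
- have mp (g : R -> R) : measurable_fun setT g ->
      measurable_fun setT (fun x => (`|(EFin \o g) x| `^ 2)%E).
    by move=> mg; apply: (measurableT_comp (measurable_poweR _));
      apply: measurableT_comp => //; exact/measurable_EFinP.
  apply: ge0_le_integral => //; [|exact: mp|exact: mp|].
    by move=> x _; exact: poweR_ge0.
  move=> x _; rewrite /= lee_fin ge0_ler_powR// ?nnegrE//.
  by rewrite (le_trans (fG x))// ler_norm.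
Qed.

Lemma Lfun2_mul_integ f g : f \in Lfun mu 2%:E -> g \in Lfun mu 2%:E ->
  integ (fun x => f x * g x).
Proof.
by move=> f2 g2; apply/Lfun1_integrable; exact: (Lfun2_mul_Lfun1 f2 g2).
Qed.

(** Otherwise G^2 would be at least e^2 on a set of infinite measure. *)
Lemma Lfun2_small G (D : set R) (e : R) : G \in Lfun mu 2%:E ->
  measurable D -> mu D = +oo%E -> 0 < e -> exists2 x, D x & `|G x| <= e.
Proof.
move=> G2 mD Doo e0; apply: contrapT => small.
have large x : D x -> e < `|G x|.
  by move=> Dx; rewrite ltNge; apply/negP => Ge; apply: small; exists x.
have iG : mu.-integrable D (EFin \o (fun x => G x ^+ 2)).
  have iT : integ (fun x => G x ^+ 2) by exact: Lfun2_integrable_sqr.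
  by apply: (integrableS _ _ _ iT).
have := @integrable_lty _ _ _ mu D mD _ iG; rewrite ltNge => /negP; apply.
have <- : (\int[mu]_(x in D) (cst (e ^+ 2)%:E) x = +oo)%E.
  by rewrite integral_cst// [X in (_ * X)%E]Doo gt0_muley// lte_fin exprn_gt0.
apply: ge0_le_integral => //.
- by move=> x _; rewrite lee_fin sqr_ge0.
- exact: measurable_int iG.
- move=> x /large eG /=; rewrite lee_fin -(real_normK (num_real (G x))).
  by rewrite ler_sqr ?nnegrE ?normr_ge0// ltW.
Qed.

Lemma itvy_infinite (b : R) : mu `[b, +oo[%classic = +oo%E.
Proof. by rewrite lebesgue_measure_itv/= ltry. Qed.

Lemma itvNy_infinite (b : R) : mu `]-oo, b]%classic = +oo%E.
Proof. by rewrite lebesgue_measure_itv/= ltNyr. Qed.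

(** The lower limit of |f| is 0 at both ends of the line.  This is weaker than
    having limit 0, so that it also covers square-integrable functions. *)
Definition small_at_ends f := forall (e b : R), 0 < e ->
  (exists2 x, b <= x & `|f x| <= e) /\ (exists2 x, x <= b & `|f x| <= e).

Lemma Lfun2_small_at_ends f G : G \in Lfun mu 2%:E ->
  (forall x, `|f x| <= G x) -> small_at_ends f.
Proof.
move=> G2 fG e b e0; split.
  have [x] := Lfun2_small G2 (measurable_itv `[b, +oo[) (itvy_infinite b) e0.
  rewrite /= in_itv/= andbT => bx Ge; exists x => //.
  by rewrite (le_trans (fG x))// (le_trans (ler_norm _)).
have [x] := Lfun2_small G2 (measurable_itv `]-oo, b]) (itvNy_infinite b) e0.
rewrite /= in_itv/= => bx Ge; exists x => //.
by rewrite (le_trans (fG x))// (le_trans (ler_norm _)).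
Qed.

Lemma cvg0_small_at_ends f : f x @[x --> +oo] --> (0 : R) ->
  f x @[x --> -oo] --> (0 : R) -> small_at_ends f.
Proof.
move=> fy fNy e b e0; split.
  near (pinfty_nbhs R) => x; exists x.
    by near: x; apply: nbhs_pinfty_ge; exact: num_real.
  by near: x; move/cvgr0Pnorm_le : fy; exact.
near (ninfty_nbhs R) => x; exists x.
  by near: x; apply: nbhs_ninfty_le; exact: num_real.
by near: x; move/cvgr0Pnorm_le : fNy; exact.
Unshelve. all: by end_near. Qed.

Lemma small_at_endsZ (r : R) (f : R -> R) :
  small_at_ends f -> small_at_ends (fun x => r * f x).
Proof.
move=> sf e b e0; have r0 : 0 < `|r| + 1 by rewrite ltr_wpDl.
have le x : `|f x| <= e / (`|r| + 1) -> `|r * f x| <= e.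
  rewrite ler_pdivlMr// => fe; rewrite normrM mulrC (le_trans _ fe)//.
  by rewrite ler_wpM2l// lerDl.
have [[x bx fx] [y yb fy]] := sf (e / (`|r| + 1)) b (divr_gt0 e0 r0).
by split; [exists x => //; exact: le|exists y => //; exact: le].
Qed.

(** Integrals of the derivative over [a_n, b_n] converge to the integral over
    the line by dominated convergence, for any a_n and b_n going to the two
    infinities; these are chosen such that f(a_n) and f(b_n) tend to 0. *)
Lemma integral_derive_eq0 f : Ck 1 [set: R] f -> integ (fun x => 'D_1 f x) ->
  small_at_ends f -> \int[mu]_x 'D_1 f x = 0.
Proof.
move=> [df cf] If sf.
have df1 x : derivable f x 1 by apply: diff_derivable; exact: df.
have posn n : (0 : R) < n.+1%:R^-1 by rewrite invr_gt0.
have /choice[b hb] : forall n : nat, exists x, n.+1%:R <= x /\ `|f x| <= n.+1%:R^-1.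
  by move=> n; have [[x h1 h2] _] := sf _ n.+1%:R (posn n); exists x.
have /choice[a ha] : forall n : nat, exists x, x <= - n.+1%:R /\ `|f x| <= n.+1%:R^-1.
  by move=> n; have [_ [x h1 h2]] := sf _ (- n.+1%:R) (posn n); exists x.
have ab n : a n < b n.
  have h1 := (hb n).1; have h2 := (ha n).1.
  by have : (0 : R) < n.+1%:R by []; lra.
pose F_ n := (EFin \o (fun x => 'D_1 f x)) \_ `[a n, b n].
have mf := measurable_int _ If.
have mF n : measurable_fun setT (F_ n).
  by apply/(measurable_restrictT _ _).1 => //; exact: measurable_funTS.
have FTC n : (\int[mu]_x F_ n x = (f (b n) - f (a n))%:E)%E.
  rewrite /F_ -integral_mkcond EFinB; apply: continuous_FTC2 => //.
  - by apply: continuous_subspaceT => x; exact: cf.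
  - have cfx x : {for x, continuous f}.
      by apply: differentiable_continuous; exact: df.
    split => //; first exact: cvg_at_right_filter (cfx _).
    exact: cvg_at_left_filter (cfx _).
  - by move=> x _; rewrite derive1E.
have [||_ _ L] := @dominated_convergence _ _ _ mu setT measurableT
  F_ _ _ mF mf _ (integrable_abse If).
- apply: aeW => x _; apply: cvg_near_cst; near=> n.
  rewrite /F_ patchE mem_set//= in_itv/=; apply/andP; split.
    rewrite (le_trans (ha n).1)// lerNl (@le_trans _ _ n%:R)//; last by rewrite ler_nat.
    by near: n; exact: nbhs_infty_ger.
  rewrite (le_trans _ (hb n).1)// (@le_trans _ _ n%:R)//; last by rewrite ler_nat.
  by near: n; exact: nbhs_infty_ger.
- apply: aeW => x n _; rewrite /F_ patchE; case: ifPn => //= _.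
  by rewrite normr0 lee_fin.
have L0 : (\int[mu]_x F_ n x)%E @[n --> \oo] --> 0%E.
  rewrite (_ : (fun n => _) = (fun n => (f (b n) - f (a n))%:E)); last first.
    by apply/funext => n; exact: FTC.
  apply: cvg_EFin; first exact: nearW.
  have fb0 : f (b n) @[n --> \oo] --> (0 : R).
    apply: norm_cvg0; apply: (@squeeze_cvgr _ _ _ _ (cst 0) (fun n => n.+1%:R^-1)).
    - by apply: nearW => n; rewrite normr_ge0 (hb n).2.
    - exact: cvg_cst.
    - exact: cvg_harmonic.
  have fa0 : f (a n) @[n --> \oo] --> (0 : R).
    apply: norm_cvg0; apply: (@squeeze_cvgr _ _ _ _ (cst 0) (fun n => n.+1%:R^-1)).
    - by apply: nearW => n; rewrite normr_ge0 (ha n).2.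
    - exact: cvg_cst.
    - exact: cvg_harmonic.
  by rewrite -[X in _ --> X]subr0; exact: cvgB.
by rewrite /Rintegral (cvg_unique _ L L0).
Unshelve. all: by end_near. Qed.

End Integrals.

(** * Differentiation under the integral sign *)

Section DerivativeUnderIntegral.
Context {R : realType} {n : nat}.
Local Notation mu := (@lebesgue_measure R).
Local Notation integ f := (mu.-integrable setT (EFin \o f)).
Local Notation Q := 'cV[R]_n.

Lemma dominated_cvg_real (G_ : nat -> R -> R) (f g : R -> R) :
  (forall m, integ (G_ m)) -> (forall x, G_ m x @[m --> \oo] --> f x) ->
  integ g -> (forall m x, `|G_ m x| <= g x) ->
  integ f /\ \int[mu]_x G_ m x @[m --> \oo] --> \int[mu]_x f x.
Proof.
move=> iG cG ig Gg.
have mG m : measurable_fun setT (EFin \o G_ m) := measurable_int _ (iG m).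
have cGE x : (G_ m x)%:E @[m --> \oo] --> (f x)%:E.
  by apply: cvg_EFin; [exact: nearW|exact: cG].
have mf : measurable_fun setT (EFin \o f).
  by apply: emeasurable_fun_cvg (fun x _ => cGE x) => m; exact: mG.
have [||i_f _ L] := @dominated_convergence _ _ _ mu setT measurableT
    (fun m => EFin \o G_ m) _ _ mG mf _ ig.
- by apply: aeW => x _; exact: cGE.
- by apply: aeW => x m _; rewrite /= lee_fin.
split=> //; apply: fine_cvg; rewrite /Rintegral fineK//.
exact: integrable_fin_num.
Qed.

Lemma coord_le_norm (d : Q) (j : 'I_n) : `|d j 0| <= `|d|.
Proof.
rewrite [`|d|]mx_normrE.
exact: (@le_bigmax _ _ _ 0 (fun i : 'I_n * 'I_1 => `|d i.1 i.2|) (j, 0)).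
Qed.

Lemma derive_sum_basis (f : Q -> R) (q d : Q) : differentiable f q ->
  'D_d f q = \sum_j d j 0 * 'D_(Defs.basis j) f q.
Proof.
move=> df; rewrite deriveE// {1}(matrix_sum_delta d) linear_sum.
by apply: eq_bigr => j _; rewrite big_ord1 linearZ deriveE.
Qed.

Lemma derive_dir_le (f : Q -> R) (q d : Q) (c : R) : differentiable f q ->
  (forall k, `|'D_(Defs.basis k) f q| <= c) -> `|'D_d f q| <= `|d| * (c *+ n).
Proof.
move=> df fc; rewrite derive_sum_basis// (le_trans (ler_norm_sum _ _ _))//.
rewrite (@le_trans _ _ (\sum_(j < n) `|d| * c))//; last first.
  by rewrite sumr_const card_ord mulrnAr.
by apply: ler_sum => j _; rewrite normrM ler_pM// coord_le_norm.
Qed.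

(** The bound on the partial derivatives holds on a ball, which is convex, so the
    mean value theorem applies on the segment from q to p. *)
Lemma increment_le (f : Q -> R) (q p : Q) (r c : R) :
  (forall y, ball q r y ->
     differentiable f y /\ forall k, `|'D_(Defs.basis k) f y| <= c) ->
  ball q r p -> `|f p - f q| <= `|p - q| * (c *+ n).
Proof.
move=> H qp; set d := p - q.
have inb (s : R) : s \in `[0, 1] -> ball q r (q + s *: d).
  rewrite in_itv/= => /andP[s0 s1]; move: qp; rewrite -ball_normE /= => qp.
  rewrite opprD addrA subrr sub0r normrN normrZ (ger0_norm s0).
  by rewrite (le_lt_trans _ qp)// distrC -/d ler_piMl.
pose F s := f (q + s *: d).
have dF (s : R) : s \in `[0, 1] -> is_derive s 1 F ('D_d f (q + s *: d)).
  move=> /inb /H[df _]; apply: is_derive_along_line.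
  exact: diff_derivable.
have cF : {within `[0, 1], continuous F}.
  by apply: derivable_within_continuous => s st; have [] := dF s st.
have [s s01] := MVT (@ltr01 R) (fun (s : R) st => dF s (subset_itv_oo_cc st)) cF.
have -> : F 1 - F 0 = f p - f q.
  by rewrite /F scale0r addr0 scale1r /d [q + _]addrC subrK.
rewrite subr0 mulr1 => ->.
have [df fc] := H _ (inb s (subset_itv_oo_cc s01)).
exact: derive_dir_le.
Qed.

(** Only the differentiability of gamma at t is available, so the integrand need
    not be dominated after differentiation in s.  Its difference quotients are:
    they are at most the Lipschitz bound of phi times the quotients of gamma,
    which converge. *)
Lemma derive_under_integral (phi : Q -> R -> R) (g : R -> R) (gamma : R -> Q)
    (t : R) :
  integ g -> (\forall q \near gamma t, integ (phi q)) ->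
  (\forall q \near gamma t, forall x, differentiable (phi ^~ x) q /\
     forall k, `|'D_(Defs.basis k) (phi ^~ x) q| <= g x) ->
  derivable gamma t 1 ->
  integ (fun x => 'D_('D_1 gamma t) (phi ^~ x) (gamma t)) /\
  is_derive t 1 (fun s => \int[mu]_x phi (gamma s) x)
    (\int[mu]_x 'D_('D_1 gamma t) (phi ^~ x) (gamma t)).
Proof.
move=> ig iphi dphi dg; set q0 := gamma t; set v := 'D_1 gamma t.
have /nbhs_ballP[r /= r0 Hr] : \forall q \near q0, integ (phi q) /\
    forall x, differentiable (phi ^~ x) q /\
     forall k, `|'D_(Defs.basis k) (phi ^~ x) q| <= g x.
  by near=> q; split; near: q.
(* The sign of g is unknown when n = 0, since then it bounds nothing; its
   n-fold sum is nonnegative in all cases. *)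
have gn0 x : 0 <= g x *+ n.
  have [_ h] := (Hr q0 (ballxx _ r0)).2 x.
  rewrite -[n]card_ord -sumr_const; apply: sumr_ge0 => k _.
  by rewrite (le_trans _ (h k)).
have dgt : differentiable gamma t by apply/derivable1_diffP.
have cg : h^-1 *: ((gamma \o shift t) (h *: 1) - gamma t) @[h --> 0^'] --> v.
  exact: dg.
have [e e0 He] : exists2 e : R, 0 < e & forall h, `|h| < e -> h != 0 ->
    ball q0 r (gamma (h + t)) /\
    `|h^-1 *: (gamma (h + t) - q0)| <= `|v| + 1.
  have c1 : \forall h \near 0^', ball q0 r (gamma (h + t)).
    apply: cvg_within; have : gamma (h + t) @[h --> (0 : R)] --> gamma t.
      have h0 : h + t @[h --> (0 : R)] --> t.
        by rewrite -[X in _ --> X]add0r; apply: cvgD; [exact: cvg_id|exact: cvg_cst].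
      apply: (@cvg_comp _ _ _ (fun h : R => h + t) gamma _ _ _ h0).
      have := differentiable_continuous dgt.
      exact.
    by move=> /(_ (ball q0 r)); apply; exact: nbhsx_ballx.
  have c2 : \forall h \near 0^', `|h^-1 *: (gamma (h + t) - q0)| <= `|v| + 1.
    have /cvgrPdist_le/(_ 1 ltr01) := cg; apply: filterS => h /=.
    rewrite [h *: 1]mulr1 => hv.
    rewrite -[X in `|X|](subrK v) addrC (le_trans (ler_normD _ _))//.
    by rewrite lerD2l// distrC.
  have [e /= e0 He] : \forall h \near 0^', ball q0 r (gamma (h + t)) /\
    `|h^-1 *: (gamma (h + t) - q0)| <= `|v| + 1 by near=> h; split; near: h.
  exists e => // h he h0; apply: He => //=.
  by rewrite sub0r normrN.
have psi_cvg x : h^-1 * (phi (gamma (h + t)) x - phi q0 x) @[h --> 0^']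
    --> 'D_v (phi ^~ x) q0.
  have [dp _] := (Hr q0 (ballxx _ r0)).2 x.
  have := @derive_comp R _ _ _ gamma (phi ^~ x) t 1 dgt dp; rewrite -/v => <-.
  have : derivable ((phi ^~ x) \o gamma) t 1.
    by apply: diff_derivable; exact: differentiable_comp.
  rewrite /derivable /derive; set F1 := (fun h => _); set F2 := (fun h => _ * _).
  by have -> : F1 = F2 by apply/funext => h; rewrite /F1/F2/= [h *: 1]mulr1.
have main (u : R^nat) : (forall m, u m != 0) -> (forall m, `|u m| < e) ->
    u m @[m --> \oo] --> (0 : R) ->
    integ (fun x => 'D_v (phi ^~ x) q0) /\
    (u m)^-1 * (\int[mu]_x phi (gamma (u m + t)) x - \int[mu]_x phi q0 x)
      @[m --> \oo] --> \int[mu]_x 'D_v (phi ^~ x) q0.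
  move=> u0 ue ucvg.
  pose G_ m x := (u m)^-1 * (phi (gamma (u m + t)) x - phi q0 x).
  have i1 m : integ (phi (gamma (u m + t))).
    by have [/Hr[]] := He (u m) (ue m) (u0 m).
  have i0 : integ (phi q0) by have [] := Hr q0 (ballxx _ r0).
  have iG m : integ (G_ m).
    have := @integrableZl _ _ _ mu setT measurableT (u m)^-1 _
      (integrableB measurableT (i1 m) i0).
    exact.
  have cG x : G_ m x @[m --> \oo] --> 'D_v (phi ^~ x) q0.
    by have /cvgr_dnbhsP := psi_cvg x; apply.
  have idom : integ (fun x => (`|v| + 1) * n%:R * g x).
    have := @integrableZl _ _ _ mu setT measurableT ((`|v| + 1) * n%:R) _ ig.
    exact.
  have [|iD L] := dominated_cvg_real iG cG idom.
    move=> m x; rewrite /G_ normrM.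
    have [inb le1] := He (u m) (ue m) (u0 m).
    have /(_ _ inb) := @increment_le (phi ^~ x) q0 (gamma (u m + t)) r (g x).
    move=> /(_ (fun y yb => (Hr y yb).2 x)) incr.
    rewrite (le_trans (ler_wpM2l _ incr))// mulrA -normrZ.
    by rewrite -mulrA mulr_natl ler_wpM2r.
  split=> //; move: L.
  suff -> : (fun m => \int[mu]_x G_ m x) = (fun m => (u m)^-1 *
      (\int[mu]_x phi (gamma (u m + t)) x - \int[mu]_x phi q0 x)) by [].
  apply/funext => m; rewrite -RintegralB// -RintegralZl//.
  have := @integrableB _ _ _ mu setT measurableT _ _ (i1 m) i0.
  exact.
have eh0 : (0 : R) < e / 2 by rewrite divr_gt0.
have [||| iD _] := main (fun m => e / 2 * m.+1%:R^-1).
- by move=> m; rewrite mulf_neq0 ?gt_eqF ?invr_eq0.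
- move=> m; rewrite ger0_norm ?mulr_ge0 ?ltW// (@le_lt_trans _ _ (e / 2))//.
    by rewrite ler_piMr ?(ltW eh0)// invf_le1// ler1n.
  by rewrite ltr_pdivrMr// ltr_pMr// ltr1n.
- rewrite -[X in _ --> X](mulr0 (e / 2)).
  by apply: cvgM; [exact: cvg_cst|exact: cvg_harmonic].
split=> //.
have L : h^-1 * (\int[mu]_x phi (gamma (h + t)) x - \int[mu]_x phi q0 x)
    @[h --> 0^'] --> \int[mu]_x 'D_v (phi ^~ x) q0.
  apply/cvgr_dnbhsP => u [u0 ucvg].
  have [N _ HN] := (cvgr0Pnorm_lt _).1 ucvg _ e0.
  rewrite -(cvg_shiftn N); apply: (main (fun m => u (m + N)%N) _ _ _).2.
  - by move=> m.
  - by move=> m; apply: HN; rewrite /= leq_addl.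
  - by rewrite (cvg_shiftn N).
pose F s := \int[mu]_x phi (gamma s) x.
have {}L : h^-1 *: ((F \o shift t) (h *: 1) - F t) @[h --> 0^']
    --> \int[mu]_x 'D_v (phi ^~ x) q0.
  move: L; set F1 := (fun h => _); set F2 := (fun h => _ *: _).
  by have -> : F1 = F2 by apply/funext => h; rewrite /F1/F2/= [h *: 1]mulr1.
apply: DeriveDef; first exact: cvgP L.
exact: cvg_lim L.
Unshelve. all: by end_near. Qed.

(** The previous lemma on the line through q with direction d. *)
Lemma derive_under_integral_dir (phi : Q -> R -> R) (g : R -> R) (q d : Q) :
  integ g -> (\forall p \near q, integ (phi p)) ->
  (\forall p \near q, forall x, differentiable (phi ^~ x) p /\
     forall k, `|'D_(Defs.basis k) (phi ^~ x) p| <= g x) ->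
  integ (fun x => 'D_d (phi ^~ x) q) /\
  is_derive q d (fun p => \int[mu]_x phi p x) (\int[mu]_x 'D_d (phi ^~ x) q).
Proof.
move=> ig iphi dphi; pose line (s : R) : Q := q + s *: d.
have l0 : line 0 = q by rewrite /line scale0r addr0.
have [dl dlE] : is_derive (0 : R) (1 : R) line d.
  rewrite -[X in is_derive _ _ _ X](derive_id (q + 0 *: d)).
  by apply: (@is_derive_along_line R _ _ id) => //; exact: derivable_id.
have := @derive_under_integral phi g line 0 ig.
rewrite l0 dlE => /(_ iphi dphi dl)[i1 [d1 e1]]; split; first exact: i1.
have [|E1 E2] := @same_growth R _ _ _ (fun p => \int[mu]_x phi p x)
  (fun s : R => \int[mu]_x phi (line s) x) q d 0 1.
  by move=> r; rewrite /line [r *: 1]mulr1 add0r.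
by apply: DeriveDef; [exact/E2|rewrite E1].
Qed.

End DerivativeUnderIntegral.

(** * Complex-valued functions of a real variable *)

Section ComplexFunctions.
Context {R : realType}.
Local Notation mu := (@lebesgue_measure R).
Local Notation integ f := (mu.-integrable setT (EFin \o f)).
Local Notation C := (R[i]).

Lemma complex_eta (z : C) : complex.Re z +i* complex.Im z = z.
Proof. by case: z. Qed.

Lemma cReD (z w : C) : complex.Re (z + w) = complex.Re z + complex.Re w.
Proof. by case: z w => a b []. Qed.

Lemma cImD (z w : C) : complex.Im (z + w) = complex.Im z + complex.Im w.
Proof. by case: z w => a b []. Qed.

Lemma cReZ (c : R) (z : C) : complex.Re (c%:C * z) = c * complex.Re z.
Proof. by case: z => a b /=; rewrite mul0r subr0. Qed.

Lemma cImZ (c : R) (z : C) : complex.Im (c%:C * z) = c * complex.Im z.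
Proof. by case: z => a b /=; rewrite mul0r addr0. Qed.

Lemma cRe_conj (z : C) : complex.Re z^* = complex.Re z.
Proof. by case: z. Qed.

Lemma cRe_sum (n : nat) (F : 'I_n -> C) :
  complex.Re (\sum_j F j) = \sum_j complex.Re (F j).
Proof. by rewrite raddf_sum. Qed.

Lemma cIm_sum (n : nat) (F : 'I_n -> C) :
  complex.Im (\sum_j F j) = \sum_j complex.Im (F j).
Proof. by rewrite raddf_sum. Qed.

Lemma half_complex : (2^-1 : C) = (2^-1)%:C.
Proof. by rewrite [RHS]rmorphV ?unitfE ?pnatr_eq0// rmorph_nat. Qed.

Lemma wirtinger_parts (a b c d : R) :
  2^-1 * ((a +i* b) - 'i%C * (c +i* d)) = ((a + d) / 2) +i* ((b - c) / 2).
Proof.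
rewrite half_complex; apply/eqP; rewrite eq_complex /=.
by apply/andP; split; apply/eqP; ring.
Qed.

Lemma wirtinger_conj_parts (a b c d : R) :
  2^-1 * ((a +i* b) + 'i%C * (c +i* d)) = ((a - d) / 2) +i* ((b + c) / 2).
Proof.
rewrite half_complex; apply/eqP; rewrite eq_complex /=.
by apply/andP; split; apply/eqP; ring.
Qed.

Lemma Im_mulNi (z : R[i]) : complex.Im (- 'i%C * z) = - complex.Re z.
Proof. by case: z => a b /=; ring. Qed.

Lemma solve_mulNi (a b f : R[i]) :
  a + b + - 'i%C * f = 0 -> f = - 'i%C * a + - 'i%C * b.
Proof.
move: a b f => [a1 a2] [b1 b2] [f1 f2].
move=> /eqP; rewrite eq_complex /= => /andP[/eqP e1 /eqP e2].
by apply/eqP; rewrite eq_complex /=; apply/andP; split; apply/eqP; lra.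
Qed.

Lemma add_conj_real (a b : R[i]) :
  a + b + (a + b)^* = ((complex.Re a + complex.Re b) * 2)%:C.
Proof.
move: a b => [a1 a2] [b1 b2].
by apply/eqP; rewrite eq_complex /=; apply/andP; split; apply/eqP; ring.
Qed.

Lemma norm_parts_le (z : C) (r : R) : `|z| <= r%:C ->
  `|complex.Re z| <= r /\ `|complex.Im z| <= r.
Proof.
rewrite normc_def lecR => zr.
split; rewrite (le_trans _ zr)// -sqrtr_sqr ler_sqrt ?addr_ge0 ?sqr_ge0//.
  by rewrite lerDl sqr_ge0.
by rewrite lerDr sqr_ge0.
Qed.

Implicit Types f g : R -> C.

Lemma cintD f g : cintegrable f -> cintegrable g ->
  cintegrable (fun x => f x + g x) /\
  cint (fun x => f x + g x) = cint f + cint g.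
Proof.
move=> [f1 f2] [g1 g2].
have fgE (u v : R -> R) : integ u -> integ v -> integ (fun x => u x + v x).
  move=> iu iv.
  have := @integrableD _ _ _ mu setT measurableT _ _ iu iv.
  exact.
have RE : (fun x => complex.Re (f x + g x)) =
    (fun x => complex.Re (f x) + complex.Re (g x)).
  by apply/funext => x; rewrite raddfD.
have IE : (fun x => complex.Im (f x + g x)) =
    (fun x => complex.Im (f x) + complex.Im (g x)).
  by apply/funext => x; rewrite raddfD.
rewrite /cintegrable /cint RE IE; split; first by split; exact: fgE.
by rewrite !RintegralD.
Qed.

Lemma integ_lincomb (u v : R -> R) (c d : R) : integ u -> integ v ->
  integ (fun x => c * u x + d * v x) /\
  \int[mu]_x (c * u x + d * v x) = c * \int[mu]_x u x + d * \int[mu]_x v x.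
Proof.
move=> iu iv.
have icu : integ (fun x => c * u x).
  have := @integrableZl _ _ _ mu setT measurableT c _ iu; exact.
have idv : integ (fun x => d * v x).
  have := @integrableZl _ _ _ mu setT measurableT d _ iv; exact.
split; last by rewrite RintegralD// !RintegralZl.
have := @integrableD _ _ _ mu setT measurableT _ _ icu idv; exact.
Qed.

Lemma cintZ (c : C) f : cintegrable f ->
  cintegrable (fun x => c * f x) /\ cint (fun x => c * f x) = c * cint f.
Proof.
case: c => c d [f1 f2].
have RE : (fun x => complex.Re ((c +i* d) * f x)) =
    (fun x => c * complex.Re (f x) + (- d) * complex.Im (f x)).
  by apply/funext => x; case: (f x) => u v /=; ring.
have IE : (fun x => complex.Im ((c +i* d) * f x)) =
    (fun x => c * complex.Im (f x) + d * complex.Re (f x)).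
  by apply/funext => x; case: (f x) => u v /=; ring.
have [i1 e1] := integ_lincomb c (- d) f1 f2.
have [i2 e2] := integ_lincomb c d f2 f1.
rewrite /cintegrable /cint RE IE; split=> //.
rewrite e1 e2; apply/eqP; rewrite eq_complex /=.
by apply/andP; split; apply/eqP; ring.
Qed.

Lemma cint_conj f : cintegrable f ->
  cintegrable (fun x => (f x)^*) /\ cint (fun x => (f x)^*) = (cint f)^*.
Proof.
move=> [f1 f2].
have RE : (fun x => complex.Re (f x)^*) = (fun x => complex.Re (f x)).
  by apply/funext => x; case: (f x).
have IE : (fun x => complex.Im (f x)^*) =
    (fun x => (-1) * complex.Im (f x) + 0 * complex.Re (f x)).
  by apply/funext => x; case: (f x) => u v /=; ring.
have [i2 e2] := integ_lincomb (-1) 0 f2 f1.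
rewrite /cintegrable /cint RE IE; split=> //.
by rewrite e2; apply/eqP; rewrite eq_complex /= mulN1r mul0r addr0 !eqxx.
Qed.

Lemma cint_sum (n : nat) (f : 'I_n -> R -> C) : (forall j, cintegrable (f j)) ->
  cintegrable (fun x => \sum_j f j x) /\
  cint (fun x => \sum_j f j x) = \sum_j cint (f j).
Proof.
move=> If.
have E (s : seq 'I_n) : cintegrable (fun x => \sum_(j <- s) f j x) /\
    cint (fun x => \sum_(j <- s) f j x) = \sum_(j <- s) cint (f j).
  elim: s => [|j s [IH1 IH2]].
    have -> : (fun x : R => \sum_(j <- [::]) f j x) = (fun=> 0).
      by apply/funext => x; rewrite big_nil.
    rewrite big_nil /cintegrable /cint /=; split.
      by split; exact: integrable0.
    by rewrite /Rintegral integral0.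
  have -> : (fun x => \sum_(i <- j :: s) f i x) =
      (fun x => f j x + \sum_(i <- s) f i x).
    by apply/funext => x; rewrite big_cons.
  rewrite big_cons -IH2; exact: cintD.
exact: E.
Qed.

Lemma mulcJ (z w : C) : z * w^* =
  (complex.Re z * complex.Re w + complex.Im z * complex.Im w) +i*
  (complex.Im z * complex.Re w - complex.Re z * complex.Im w).
Proof.
case: z w => a b [c d]; apply/eqP; rewrite eq_complex /=.
by apply/andP; split; apply/eqP; ring.
Qed.

Lemma mul_conj_cintegrable f g : inH f -> inH g -> cintegrable (fun x => f x * (g x)^*).
Proof.
move=> [f1 f2] [g1 g2].
have RE : (fun x => complex.Re (f x * (g x)^*)) =
    (fun x => 1 * (complex.Re (f x) * complex.Re (g x)) +
              1 * (complex.Im (f x) * complex.Im (g x))).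
  by apply/funext => x; rewrite mulcJ /= !mul1r.
have IE : (fun x => complex.Im (f x * (g x)^*)) =
    (fun x => 1 * (complex.Im (f x) * complex.Re (g x)) +
              (-1) * (complex.Re (f x) * complex.Im (g x))).
  by apply/funext => x; rewrite mulcJ /= !mul1r mulN1r.
rewrite /cintegrable RE IE.
by split; apply: (integ_lincomb _ _ _ _).1; exact: Lfun2_mul_integ.
Qed.

Lemma inHD f g : inH f -> inH g -> inH (fun x => f x + g x).
Proof.
move=> [f1 f2] [g1 g2]; split.
  have -> : (fun x => complex.Re (f x + g x)) =
      (fun x => complex.Re (f x)) + (fun x => complex.Re (g x)).
    by apply/funext => x; rewrite raddfD.
  by apply: (Lfun_addr_closed mu _).2 => //; rewrite lee_fin ler1n.
have -> : (fun x => complex.Im (f x + g x)) =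
    (fun x => complex.Im (f x)) + (fun x => complex.Im (g x)).
  by apply/funext => x; rewrite raddfD.
by apply: (Lfun_addr_closed mu _).2 => //; rewrite lee_fin ler1n.
Qed.

Lemma inHZ (c : R) f : inH f -> inH (fun x => f x * c%:C).
Proof.
move=> [f1 f2]; split.
  have -> : (fun x => complex.Re (f x * c%:C)) = (fun x => complex.Re (f x) * c).
    by apply/funext => x; case: (f x) => u v /=; ring.
  by apply: (@Lfun_scale _ _ _ mu _ c 2) => //; rewrite ler1n.
have -> : (fun x => complex.Im (f x * c%:C)) = (fun x => complex.Im (f x) * c).
  by apply/funext => x; case: (f x) => u v /=; ring.
by apply: (@Lfun_scale _ _ _ mu _ c 2) => //; rewrite ler1n.
Qed.

Lemma inH0 : inH (fun _ : R => 0 : C).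
Proof.
split; by apply: (Lfun_addr_closed mu _).1 => //; rewrite lee_fin ler1n.
Qed.

Lemma inH_sum (n : nat) (f : 'I_n -> R -> C) : (forall j, inH (f j)) ->
  inH (fun x => \sum_j f j x).
Proof.
move=> Hf; have E (s : seq 'I_n) : inH (fun x => \sum_(j <- s) f j x).
  elim: s => [|j s IH].
    have -> : (fun x : R => \sum_(j <- [::]) f j x) = (fun=> 0).
      by apply/funext => x; rewrite big_nil.
    exact: inH0.
  have -> : (fun x => \sum_(i <- j :: s) f i x) =
      (fun x => f j x + \sum_(i <- s) f i x).
    by apply/funext => x; rewrite big_cons.
  exact: inHD.
exact: E.
Qed.

Lemma innerDl f1 f2 g : inH f1 -> inH f2 -> inH g ->
  inner (fun x => f1 x + f2 x) g = inner f1 g + inner f2 g.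
Proof.
move=> h1 h2 hg; rewrite /inner.
have [_ <-] := cintD (mul_conj_cintegrable h1 hg) (mul_conj_cintegrable h2 hg).
by congr cint; apply/funext => x; rewrite mulrDl.
Qed.

Lemma inner_conj f g : inH f -> inH g -> inner g f = (inner f g)^*.
Proof.
move=> hf hg; rewrite /inner.
have [_ <-] := cint_conj (mul_conj_cintegrable hf hg).
congr cint; apply/funext => x; case: (f x) (g x) => a b [c d].
by apply/eqP; rewrite eq_complex /=; apply/andP; split; apply/eqP; ring.
Qed.

Lemma innerDr f g1 g2 : inH f -> inH g1 -> inH g2 ->
  inner f (fun x => g1 x + g2 x) = inner f g1 + inner f g2.
Proof.
move=> hf h1 h2; rewrite (inner_conj (inHD h1 h2) hf) innerDl// rmorphD /=.
by rewrite -!inner_conj.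
Qed.

Lemma inner_suml (n : nat) (f : 'I_n -> R -> C) (v : 'cV[R]_n) g :
  (forall j, inH (f j)) -> inH g ->
  inner (fun x => \sum_j f j x * (v j 0)%:C) g = \sum_j (v j 0)%:C * inner (f j) g.
Proof.
move=> hf hg; rewrite /inner.
have If j : cintegrable (fun x => (v j 0)%:C * (f j x * (g x)^*)).
  by apply: (cintZ _ _).1; exact: mul_conj_cintegrable.
have [_ E] := cint_sum If.
transitivity (cint (fun x => \sum_j (v j 0)%:C * (f j x * (g x)^*))).
  congr cint; apply/funext => x; rewrite mulr_suml; apply: eq_bigr => j _.
  by rewrite mulrA (mulrC (v j 0)%:C).
rewrite E; apply: eq_bigr => j _.
by have [_ ->] := cintZ (v j 0)%:C (mul_conj_cintegrable (hf j) hg).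
Qed.

Lemma inner_self f : complex.Re (inner f f) = normH f ^+ 2.
Proof.
rewrite /normH sqr_sqrtr// /inner /cint /=; apply: Rintegral_ge0 => x _.
by rewrite mulcJ /= addr_ge0// -expr2 sqr_ge0.
Qed.

Lemma derive_bilin (c : R) (u v s t : R -> R) x :
  derivable u x 1 -> derivable v x 1 -> derivable s x 1 -> derivable t x 1 ->
  'D_1 (fun y => u y * v y + c * (s y * t y)) x =
  u x * 'D_1 v x + v x * 'D_1 u x + c * (s x * 'D_1 t x + t x * 'D_1 s x).
Proof.
move=> du dv ds dt.
have duv := derivableM du dv; have dst := derivableM ds dt.
have := deriveD duv (derivableZ (k := c) dst).
by rewrite deriveZ// (deriveM du dv) (deriveM ds dt).
Qed.

Lemma cCk1M f g : cCk 1 setT f -> cCk 1 setT g ->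
  cCk 1 setT (fun x => f x * g x) /\
  forall x, dd (fun x => f x * g x) x = dd f x * g x + f x * dd g x.
Proof.
move=> [f1 f2] [g1 g2].
have RE : (fun x => complex.Re (f x * g x)) =
    (fun x => complex.Re (f x) * complex.Re (g x) +
              (-1) * (complex.Im (f x) * complex.Im (g x))).
  by apply/funext => x; case: (f x) (g x) => a b [c d] /=; ring.
have IE : (fun x => complex.Im (f x * g x)) =
    (fun x => complex.Re (f x) * complex.Im (g x) +
              complex.Im (f x) * complex.Re (g x)).
  by apply/funext => x; case: (f x) (g x) => a b [c d] /=; ring.
rewrite /cCk RE IE; split.
  split; first by apply: CkD; [exact: Ck1M|apply: CkZ; exact: Ck1M].
  by apply: CkD; exact: Ck1M.
have dC (u : R -> R) x : Ck 1 setT u -> derivable u x 1.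
  by move=> [du _]; apply: diff_derivable; exact: du.
move=> x; rewrite /dd /cD RE IE.
have df1 := dC _ x f1; have df2 := dC _ x f2.
have dg1 := dC _ x g1; have dg2 := dC _ x g2.
rewrite (derive_bilin (-1) df1 dg1 df2 dg2).
have := derive_bilin 1 df1 dg2 df2 dg1.
under eq_fun do rewrite mul1r.
move=> ->; rewrite mul1r mulN1r.
move: ('D_1 (fun a : R => complex.Re (f a)) x) => a.
move: ('D_1 (fun a : R => complex.Im (f a)) x) => b.
move: ('D_1 (fun a : R => complex.Re (g a)) x) => c.
move: ('D_1 (fun a : R => complex.Im (g a)) x) => d.
case: (f x) (g x) => u v [r s] /=; apply/eqP; rewrite eq_complex /=.
by apply/andP; split; apply/eqP; ring.
Qed.

Lemma cCk1_conj f : cCk 1 setT f ->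
  cCk 1 setT (fun x => (f x)^*) /\
  forall x, dd (fun x => (f x)^*) x = (dd f x)^*.
Proof.
move=> [f1 f2].
have RE : (fun x => complex.Re (f x)^*) = (fun x => complex.Re (f x)).
  by apply/funext => x; case: (f x).
have IE : (fun x => complex.Im (f x)^*) = (fun x => (-1) * complex.Im (f x)).
  by apply/funext => x; case: (f x) => u v /=; ring.
rewrite /cCk RE IE; split; first by split; [exact: f1|exact: CkZ].
move=> x; rewrite /dd /cD RE IE /=.
have df2 : derivable (fun x => complex.Im (f x)) x 1.
  by apply: diff_derivable; exact: f2.1.
by rewrite (deriveZ _ df2) /GRing.scale /= mulN1r.
Qed.

Lemma small_at_ends_le (u v : R -> R) : (forall x, `|u x| <= `|v x|) ->
  small_at_ends v -> small_at_ends u.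
Proof.
move=> uv sv e b /(sv _ b)[[x bx ve] [y yb ve']]; split.
  by exists x => //; rewrite (le_trans (uv x)).
by exists y => //; rewrite (le_trans (uv y)).
Qed.

(** Componentwise form of integral_derive_eq0, with a common real bound g. *)
Lemma cint_dd_eq0 f (g : R -> R) : cCk 1 setT f -> cintegrable (fun x => dd f x) ->
  small_at_ends g -> (forall x, `|f x| <= (g x)%:C) -> cint (fun x => dd f x) = 0.
Proof.
move=> [f1 f2] [i1 i2] sg fg; rewrite /cint.
have fgR x : `|complex.Re (f x)| <= `|g x|.
  by have [h _] := norm_parts_le (fg x); rewrite (le_trans h)// ler_norm.
have fgI x : `|complex.Im (f x)| <= `|g x|.
  by have [_ h] := norm_parts_le (fg x); rewrite (le_trans h)// ler_norm.
rewrite (integral_derive_eq0 f1 i1 (small_at_ends_le fgR sg)).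
by rewrite (integral_derive_eq0 f2 i2 (small_at_ends_le fgI sg)).
Qed.

Lemma cint_real (f : R -> R) : integ f ->
  cintegrable (fun x => (f x)%:C) /\ cint (fun x => (f x)%:C) = (\int[mu]_x f x)%:C.
Proof.
move=> i_f; split; first by split => //; exact: integrable0.
by rewrite /cint /= {2}/Rintegral integral0.
Qed.

Lemma Rintegral_lincomb (n : nat) (f : 'I_n -> R -> R) (c : 'I_n -> R) :
  (forall j, integ (f j)) ->
  \int[mu]_x (\sum_j c j * f j x) = \sum_j c j * \int[mu]_x f j x.
Proof.
move=> If.
have iC j := cint_real (If j); have iZ j := cintZ (c j)%:C (iC j).1.
have [_ E] := cint_sum (fun j => (iZ j).1).
have := congr1 (@complex.Re R) E; rewrite cRe_sum.
under [X in _ = X -> _]eq_bigr => j _ do rewrite (iZ j).2 (iC j).2 cReZ.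
move=> <-; congr (Rintegral _ _ _); apply/funext => x.
by rewrite cRe_sum; apply: eq_bigr => j _; rewrite cReZ.
Qed.

Lemma Ck1_measurable (f : R -> R) : Ck 1 [set: R] f -> measurable_fun setT f.
Proof.
move=> f1; apply: continuous_measurable_fun => x.
exact: (Ck1_continuous f1).
Qed.

(** Turns pointwise domination into membership of H; measurability comes from
    continuity. *)
Lemma dominated_inH (f : R -> R[i]) (G : R -> R) : cCk 1 [set: R] f ->
  G \in Lfun mu 2%:E -> (forall x, `|f x| <= (G x)%:C) -> inH f.
Proof.
move=> [f1 f2] G2 fG; split.
  apply: (dominated_Lfun2 (Ck1_measurable f1) _ G2) => x.
  by have [] := norm_parts_le (fG x).
apply: (dominated_Lfun2 (Ck1_measurable f2) _ G2) => x.
by have [] := norm_parts_le (fG x).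
Qed.

Lemma same_derive_defect (f g : R -> R) : Ck 1 [set: R] f -> Ck 1 [set: R] g ->
  (forall x, 'D_1 f x = 'D_1 g x) -> forall x, f x = g x + (f 0 - g 0).
Proof.
move=> [df _] [dg _] fg x; apply/eqP; rewrite addrC -subr_eq; apply/eqP.
apply: (@is_derive_0_is_cst _ (fun y => f y - g y)) => y.
have df1 : derivable f y 1 by apply: diff_derivable; exact: df.
have dg1 : derivable g y 1 by apply: diff_derivable; exact: dg.
apply: DeriveDef; first exact: (derivableB df1 dg1).
by rewrite (deriveB df1 dg1) fg subrr.
Qed.

Lemma same_dd_defect (f g : R -> R[i]) : cCk 1 setT f -> cCk 1 setT g ->
  (forall x, dd f x = dd g x) -> forall x, f x = g x + (f 0 - g 0).
Proof.
move=> [f1 f2] [g1 g2] fg x.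
have := same_derive_defect f1 g1 (fun x => congr1 (@complex.Re R) (fg x)) x.
have := same_derive_defect f2 g2 (fun x => congr1 (@complex.Im R) (fg x)) x.
move: (f x) (g x) (f 0) (g 0) => [a1 a2] [b1 b2] [c1 c2] [d1 d2] /= -> ->.
by apply/eqP; rewrite eq_complex /= !eqxx.
Qed.

End ComplexFunctions.

(** * Wirtinger derivatives and the chain rule *)

Section Wirtinger.
Context {R : realType}.
Variable h : R[i] -> R[i] -> R[i].

Definition h_re (z : (R * R) * (R * R)) : R :=
  complex.Re (h (z.1.1 +i* z.1.2) (z.2.1 +i* z.2.2)).
Definition h_im (z : (R * R) * (R * R)) : R :=
  complex.Im (h (z.1.1 +i* z.1.2) (z.2.1 +i* z.2.2)).
(** Identifies a pair (u, u_x) of complex numbers with a point of R^4. *)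
Definition point4 (u p : R[i]) : (R * R) * (R * R) :=
  ((complex.Re u, complex.Im u), (complex.Re p, complex.Im p)).

Lemma partial4 (F : (R * R) * (R * R) -> R) (u p : R[i]) :
  [/\ 'D_1 (fun a : R => F ((a, complex.Im u), (complex.Re p, complex.Im p)))
        (complex.Re u) = 'D_axis1 F (point4 u p),
      'D_1 (fun a : R => F ((complex.Re u, a), (complex.Re p, complex.Im p)))
        (complex.Im u) = 'D_axis2 F (point4 u p),
      'D_1 (fun a : R => F ((complex.Re u, complex.Im u), (a, complex.Im p)))
        (complex.Re p) = 'D_axis3 F (point4 u p) &
      'D_1 (fun a : R => F ((complex.Re u, complex.Im u), (complex.Re p, a)))
        (complex.Im p) = 'D_axis4 F (point4 u p)].
Proof.
by split; apply: (same_growth _).1 => r; congr (F ((_, _), (_, _)));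
  rewrite /= ?[r *: 0]mulr0 ?addr0.
Qed.

Lemma h_uE u p : h_u h u p =
  (('D_axis1 h_re (point4 u p) + 'D_axis2 h_im (point4 u p)) / 2) +i*
  (('D_axis1 h_im (point4 u p) - 'D_axis2 h_re (point4 u p)) / 2).
Proof.
have [r1 r2 _ _] := partial4 h_re u p; have [i1 i2 _ _] := partial4 h_im u p.
rewrite -{}r1 -{}r2 -{}i1 -{}i2 /h_re /h_im /= complex_eta.
exact: wirtinger_parts.
Qed.

Lemma h_ubarE u p : h_ubar h u p =
  (('D_axis1 h_re (point4 u p) - 'D_axis2 h_im (point4 u p)) / 2) +i*
  (('D_axis1 h_im (point4 u p) + 'D_axis2 h_re (point4 u p)) / 2).
Proof.
have [r1 r2 _ _] := partial4 h_re u p; have [i1 i2 _ _] := partial4 h_im u p.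
rewrite -{}r1 -{}r2 -{}i1 -{}i2 /h_re /h_im /= complex_eta.
exact: wirtinger_conj_parts.
Qed.

Lemma h_uxE u p : h_ux h u p =
  (('D_axis3 h_re (point4 u p) + 'D_axis4 h_im (point4 u p)) / 2) +i*
  (('D_axis3 h_im (point4 u p) - 'D_axis4 h_re (point4 u p)) / 2).
Proof.
have [_ _ r1 r2] := partial4 h_re u p; have [_ _ i1 i2] := partial4 h_im u p.
rewrite -{}r1 -{}r2 -{}i1 -{}i2 /h_re /h_im /= complex_eta.
exact: wirtinger_parts.
Qed.

Lemma h_uxbarE u p : h_uxbar h u p =
  (('D_axis3 h_re (point4 u p) - 'D_axis4 h_im (point4 u p)) / 2) +i*
  (('D_axis3 h_im (point4 u p) + 'D_axis4 h_re (point4 u p)) / 2).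
Proof.
have [_ _ r1 r2] := partial4 h_re u p; have [_ _ i1 i2] := partial4 h_im u p.
rewrite -{}r1 -{}r2 -{}i1 -{}i2 /h_re /h_im /= complex_eta.
exact: wirtinger_conj_parts.
Qed.

(** The kinetic part of the density is real: it is minus the
    imaginary part of u_t u^* . *)
Lemma lagr_densityE (u ut p : R[i]) : lagr_density h u ut p =
  (complex.Re ut * complex.Im u - complex.Im ut * complex.Re u)%:C + h u p.
Proof.
rewrite /lagr_density half_complex; congr (_ + _); case: u ut => a b [r s].
apply/eqP; rewrite eq_complex /=.
by apply/andP; split; apply/eqP; field.
Qed.

Hypothesis h_C2 : C2_map h.

Lemma h_re_C2 : Ck 2 setT h_re. Proof. by case: h_C2 => + _; exact. Qed.
Lemma h_im_C2 : Ck 2 setT h_im. Proof. by case: h_C2 => _; exact. Qed.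

Lemma h_re_differentiable z : differentiable h_re z.
Proof. by have [+ _] := h_re_C2; apply. Qed.
Lemma h_im_differentiable z : differentiable h_im z.
Proof. by have [+ _] := h_im_C2; apply. Qed.

(** With u, u^*, u_x and u_x^* treated as independent, the derivative of
    h(u, u_x) along v has the four terms of the holomorphic case. *)
Lemma chain_rule (V : normedModType R) (u p : V -> R[i]) (a v : V) :
  differentiable (fun y => complex.Re (u y)) a ->
  differentiable (fun y => complex.Im (u y)) a ->
  differentiable (fun y => complex.Re (p y)) a ->
  differentiable (fun y => complex.Im (p y)) a ->
  [/\ differentiable (fun y => complex.Re (h (u y) (p y))) a,
      differentiable (fun y => complex.Im (h (u y) (p y))) a &
  cD v (fun y => h (u y) (p y)) a =
  cD v u a * h_u h (u a) (p a) + (cD v u a)^* * h_ubar h (u a) (p a)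
  + cD v p a * h_ux h (u a) (p a) + (cD v p a)^* * h_uxbar h (u a) (p a)].
Proof.
move=> d1 d2 d3 d4.
have RE : (fun y => complex.Re (h (u y) (p y))) = (fun y => h_re (point4 (u y) (p y))).
  by apply/funext => y; rewrite /h_re /= !complex_eta.
have IE : (fun y => complex.Im (h (u y) (p y))) = (fun y => h_im (point4 (u y) (p y))).
  by apply/funext => y; rewrite /h_im /= !complex_eta.
have dP : differentiable (fun y => point4 (u y) (p y)) a.
  exact: differentiable_point4.
split.
- rewrite RE.
  apply: (@differentiable_comp _ _ _ _ (fun y => point4 (u y) (p y)) h_re) => //.
  exact: h_re_differentiable.
- rewrite IE.
  apply: (@differentiable_comp _ _ _ _ (fun y => point4 (u y) (p y)) h_im) => //.
  exact: h_im_differentiable.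
rewrite {1}/cD RE IE.
rewrite (derive_comp4 v d1 d2 d3 d4 (h_re_differentiable _)).
rewrite (derive_comp4 v d1 d2 d3 d4 (h_im_differentiable _)).
rewrite h_uE h_ubarE h_uxE h_uxbarE -/(point4 _ _) /cD.
set P := point4 _ _.
move: ('D_axis1 h_re P) ('D_axis2 h_re P) ('D_axis3 h_re P) ('D_axis4 h_re P).
move=> r1 r2 r3 r4.
move: ('D_axis1 h_im P) ('D_axis2 h_im P) ('D_axis3 h_im P) ('D_axis4 h_im P).
move=> i1 i2 i3 i4.
move: ('D_v (fun y => complex.Re (u y)) a) => c1.
move: ('D_v (fun y => complex.Im (u y)) a) => c2.
move: ('D_v (fun y => complex.Re (p y)) a) => c3.
move: ('D_v (fun y => complex.Im (p y)) a) => c4.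
apply/eqP; rewrite eq_complex /=.
by apply/andP; split; apply/eqP; field.
Qed.

Lemma h_ux_along_Ck1 (u p : R -> R[i]) : cCk 1 setT u -> cCk 1 setT p ->
  cCk 1 setT (fun x => h_ux h (u x) (p x)) /\
  cCk 1 setT (fun x => h_uxbar h (u x) (p x)).
Proof.
move=> [u1 u2] [p1 p2].
have C1 e : Ck 1 setT (fun x => 'D_e h_re (point4 (u x) (p x))) /\
            Ck 1 setT (fun x => 'D_e h_im (point4 (u x) (p x))).
  split.
    apply: (@Ck1_comp4 _ _ (fun z => 'D_e h_re z)) => //.
    by have [_ +] := h_re_C2; apply.
  apply: (@Ck1_comp4 _ _ (fun z => 'D_e h_im z)) => //.
  by have [_ +] := h_im_C2; apply.
have comb (F G : R -> R) c : Ck 1 setT F -> Ck 1 setT G ->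
    Ck 1 setT (fun x => 2^-1 * (F x + c * G x)).
  by move=> F1 G1; exact: (CkZ _ (CkD F1 (CkZ c G1))).
split; split.
- have -> : (fun x => complex.Re (h_ux h (u x) (p x))) = (fun x =>
    2^-1 * ('D_axis3 h_re (point4 (u x) (p x)) + 1 * 'D_axis4 h_im (point4 (u x) (p x)))).
    by apply/funext => x; rewrite h_uxE /= mulrC mul1r.
  by apply: comb; [exact: (C1 _).1|exact: (C1 _).2].
- have -> : (fun x => complex.Im (h_ux h (u x) (p x))) = (fun x =>
    2^-1 * ('D_axis3 h_im (point4 (u x) (p x)) + (-1) * 'D_axis4 h_re (point4 (u x) (p x)))).
    by apply/funext => x; rewrite h_uxE /= mulrC mulN1r.
  by apply: comb; [exact: (C1 _).2|exact: (C1 _).1].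
- have -> : (fun x => complex.Re (h_uxbar h (u x) (p x))) = (fun x =>
    2^-1 * ('D_axis3 h_re (point4 (u x) (p x)) + (-1) * 'D_axis4 h_im (point4 (u x) (p x)))).
    by apply/funext => x; rewrite h_uxbarE /= mulrC mulN1r.
  by apply: comb; [exact: (C1 _).1|exact: (C1 _).2].
- have -> : (fun x => complex.Im (h_uxbar h (u x) (p x))) = (fun x =>
    2^-1 * ('D_axis3 h_im (point4 (u x) (p x)) + 1 * 'D_axis4 h_re (point4 (u x) (p x)))).
    by apply/funext => x; rewrite h_uxbarE /= mulrC mul1r.
  by apply: comb; [exact: (C1 _).2|exact: (C1 _).1].
Qed.

End Wirtinger.

(** * Consequence of the variational form of the PDE *)

Section FirstVariation.
Context {R : realType}.

(** Affine behaviour is only required on the line through a with direction v. *)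
Lemma is_derive_affine (V : normedModType R) (f : V -> R) (a v : V) (c : R) :
  (forall r : R, f (a + r *: v) = f a + r * c) -> is_derive a v f c.
Proof.
move=> fa.
have L : r^-1 *: ((f \o shift a) (r *: v) - f a) @[r --> 0^'] --> c.
  apply: cvg_near_cst; near=> r => /=.
  rewrite [r *: v + a]addrC fa addrAC subrr add0r.
  rewrite -[LHS]/(r^-1 * (r * c)) mulrA mulVf ?mul1r//.
  by near: r; exact: nbhs_dnbhs_neq.
apply: DeriveDef; first exact: cvgP L.
exact: cvg_lim L.
Unshelve. all: by end_near. Qed.

Lemma derive_cst_add (V : normedModType R) (f : V -> R) (a v : V) (c : R) :
  'D_v (fun y => c + f y) a = 'D_v f a.
Proof.
rewrite /derive.
have -> // : (fun r : R => r^-1 *: (((fun y => c + f y) \o shift a) (r *: v) -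
    (c + f a))) = (fun r : R => r^-1 *: ((f \o shift a) (r *: v) - f a)).
by apply/funext => r /=; rewrite opprD addrACA subrr add0r.
Qed.

Lemma derive_line (c d a : R) : 'D_1 (fun s : R => c + d * s) a = d.
Proof.
have [_ ->//] : is_derive a 1 (fun s : R => c + d * s) d.
by apply: is_derive_affine => r; rewrite [r *: 1]mulr1; ring.
Qed.

Lemma derive_affine_add (f : R -> R) (a c d : R) : derivable f a 1 ->
  'D_1 (fun y : R => c + y * d + f y) a = d + 'D_1 f a.
Proof.
move=> df.
have [d1 e1] : is_derive a 1 (fun y : R => c + y * d) d.
  by apply: is_derive_affine => r; rewrite [r *: 1]mulr1; ring.
by rewrite -{2}e1 -(deriveD d1 df).
Qed.

Variable h : R[i] -> R[i] -> R[i].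

(** This is i u^* / 2, as h contains no u_t. *)
Lemma wirtinger_lagr_ut (u ut p : R[i]) :
  wirtinger (fun z => lagr_density h u z p) ut =
  (complex.Im u / 2) +i* (complex.Re u / 2).
Proof.
rewrite /wirtinger /dd /cD.
have D1 : 'D_1 (fun a : R => complex.Re (lagr_density h u (a +i* complex.Im ut) p))
    (complex.Re ut) = complex.Im u.
  apply: (@derive_val _ _ _ _ _ _ _ (is_derive_affine _)) => r.
  by rewrite !lagr_densityE !raddfD /= [r *: 1]mulr1; ring.
have D2 : 'D_1 (fun a : R => complex.Im (lagr_density h u (a +i* complex.Im ut) p))
    (complex.Re ut) = 0.
  apply: (@derive_val _ _ _ _ _ _ _ (is_derive_affine _)) => r.
  by rewrite !lagr_densityE !raddfD /=; ring.
have D3 : 'D_1 (fun b : R => complex.Re (lagr_density h u (complex.Re ut +i* b) p))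
    (complex.Im ut) = - complex.Re u.
  apply: (@derive_val _ _ _ _ _ _ _ (is_derive_affine _)) => r.
  by rewrite !lagr_densityE !raddfD /= [r *: 1]mulr1; ring.
have D4 : 'D_1 (fun b : R => complex.Im (lagr_density h u (complex.Re ut +i* b) p))
    (complex.Im ut) = 0.
  apply: (@derive_val _ _ _ _ _ _ _ (is_derive_affine _)) => r.
  by rewrite !lagr_densityE !raddfD /=; ring.
by rewrite D1 D2 D3 D4 wirtinger_parts addr0 sub0r opprK.
Qed.

Lemma wirtinger_lagr_ux (u ut p : R[i]) :
  wirtinger (fun z => lagr_density h u ut z) p = h_ux h u p.
Proof.
have E z : lagr_density h u ut z =
  (complex.Re ut * complex.Im u - complex.Im ut * complex.Re u)%:C + h u z.
  exact: lagr_densityE.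
have dE (f : R -> R[i]) a :
    dd (fun b => lagr_density h u ut (f b)) a = dd (fun b => h u (f b)) a.
  rewrite /dd /cD.
  have -> : (fun b : R => complex.Re (lagr_density h u ut (f b))) =
      (fun b => complex.Re ut * complex.Im u - complex.Im ut * complex.Re u +
                complex.Re (h u (f b))).
    by apply/funext => b; rewrite E raddfD.
  have -> : (fun b : R => complex.Im (lagr_density h u ut (f b))) =
      (fun b => 0 + complex.Im (h u (f b))).
    by apply/funext => b; rewrite E raddfD.
  by rewrite !derive_cst_add.
by rewrite /h_ux /wirtinger !dE.
Qed.

Hypothesis h_C2 : C2_map h.

(** The added term is - i (u_t)^* / 2. *)
Lemma wirtinger_lagr_u (u ut p : R[i]) :
  wirtinger (fun z => lagr_density h z ut p) u =
  h_u h u p - ((complex.Im ut / 2) +i* (complex.Re ut / 2)).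
Proof.
have dP1 a : differentiable (fun a : R => point4 (a +i* complex.Im u) p) a.
  by apply: differentiable_point4 => //=; exact: differentiable_cst.
have dP2 b : differentiable (fun b : R => point4 (complex.Re u +i* b) p) b.
  by apply: differentiable_point4 => //=; exact: differentiable_cst.
have hE z : complex.Re (h z p) = h_re h (point4 z p) /\
            complex.Im (h z p) = h_im h (point4 z p).
  by rewrite /h_re /h_im /= !complex_eta.
have dR1 a : derivable (fun a : R => complex.Re (h (a +i* complex.Im u) p)) a 1.
  under eq_fun do rewrite (hE _).1; apply: diff_derivable.
  by apply: (differentiable_comp (dP1 a)); exact: h_re_differentiable.
have dI1 a : derivable (fun a : R => complex.Im (h (a +i* complex.Im u) p)) a 1.
  under eq_fun do rewrite (hE _).2; apply: diff_derivable.
  by apply: (differentiable_comp (dP1 a)); exact: h_im_differentiable.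
have dR2 b : derivable (fun b : R => complex.Re (h (complex.Re u +i* b) p)) b 1.
  under eq_fun do rewrite (hE _).1; apply: diff_derivable.
  by apply: (differentiable_comp (dP2 b)); exact: h_re_differentiable.
have dI2 b : derivable (fun b : R => complex.Im (h (complex.Re u +i* b) p)) b 1.
  under eq_fun do rewrite (hE _).2; apply: diff_derivable.
  by apply: (differentiable_comp (dP2 b)); exact: h_im_differentiable.
rewrite /h_u /wirtinger /dd /cD.
have -> : (fun a : R => complex.Re (lagr_density h (a +i* complex.Im u) ut p)) =
  (fun a => complex.Re ut * complex.Im u + a * (- complex.Im ut) +
            complex.Re (h (a +i* complex.Im u) p)).
  by apply/funext => a; rewrite lagr_densityE raddfD /=; ring.
have -> : (fun a : R => complex.Im (lagr_density h (a +i* complex.Im u) ut p)) =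
  (fun a => 0 + complex.Im (h (a +i* complex.Im u) p)).
  by apply/funext => a; rewrite lagr_densityE raddfD /=; ring.
have -> : (fun b : R => complex.Re (lagr_density h (complex.Re u +i* b) ut p)) =
  (fun b => - (complex.Im ut * complex.Re u) + b * complex.Re ut +
            complex.Re (h (complex.Re u +i* b) p)).
  by apply/funext => a; rewrite lagr_densityE raddfD /=; ring.
have -> : (fun b : R => complex.Im (lagr_density h (complex.Re u +i* b) ut p)) =
  (fun b => 0 + complex.Im (h (complex.Re u +i* b) p)).
  by apply/funext => a; rewrite lagr_densityE raddfD /=; ring.
rewrite (derive_affine_add _ _ (dR1 _)) (derive_affine_add _ _ (dR2 _)).
rewrite !derive_cst_add !wirtinger_parts; apply/eqP; rewrite eq_complex /=.
by apply/andP; split; apply/eqP; field.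
Qed.

Lemma Ck_fst (k : nat) : Ck k [set: R * R] (fun z => z.1).
Proof.
case: k => [|k] /=.
  by move=> a _; apply: cvg_fst.
split=> [a _|v].
  by apply: linear_differentiable => z; exact: cvg_fst.
have -> : (fun a : R * R => 'D_v (fun z => z.1) a) = (fun _ => v.1) :> (_ -> R).
  apply/funext => a; apply: (@derive_val _ _ _ _ _ _ _ (is_derive_affine _)).
  by [].
exact: Ck_cst.
Qed.

Hypothesis h_conj : forall u p, (h_u h u p)^* = h_ubar h u p.

(** The equation in u^* of the first variation is the PDE itself, whereas the
    one in u is its conjugate with (h_p)_x in place of ((h_pbar)_x)^*.  The test
    function w + t T, where T is the value of the right-hand side at x, satisfies the
    PDE at (0, x); the two equations compared there give the claim. *)
Lemma conj_dd_h_ux (w : R -> R[i]) (x : R) : first_variation_leads_to_pde h ->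
  cCk 2 setT w ->
  dd (fun y => h_ux h (w y) (dd w y)) x =
  (dd (fun y => h_uxbar h (w y) (dd w y)) x)^*.
Proof.
move=> h_pde [w1 w2].
have [T TE] : exists T, T = pde_rhs h w x by eexists.
pose u (t y : R) := w y + t%:C * T.
have uE t y : [/\ u t y = w y + t%:C * T,
    complex.Re (u t y) = complex.Re (w y) + complex.Re T * t &
    complex.Im (u t y) = complex.Im (w y) + complex.Im T * t].
  by split=> //; rewrite /u raddfD /=; case: (T) => a b /=; ring.
have u_C2 : cCk 2 setT (fun z : R * R => u z.1 z.2).
  have snd_C2 (f : R -> R) : Ck 2 setT f -> Ck 2 setT (fun z : R * R => f z.2).
    move=> f2; apply: (@Ck_affine_comp _ _ _ snd snd 2 setT f) => // z.
    by apply: linear_differentiable => z'; exact: cvg_snd.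
  split.
    have -> : (fun z : R * R => complex.Re (u z.1 z.2)) =
        (fun z : R * R => complex.Re (w z.2) + complex.Re T * z.1).
      by apply/funext => z; have [_ -> _] := uE z.1 z.2.
    exact: (CkD (snd_C2 _ w1) (CkZ (complex.Re T) (Ck_fst 2))).
  have -> : (fun z : R * R => complex.Im (u z.1 z.2)) =
      (fun z : R * R => complex.Im (w z.2) + complex.Im T * z.1).
    by apply/funext => z; have [_ _ ->] := uE z.1 z.2.
  exact: (CkD (snd_C2 _ w2) (CkZ (complex.Im T) (Ck_fst 2))).
have u0 : u 0 = w by apply/funext => y; rewrite /u mul0r addr0.
have duT : dt u 0 x = T.
  rewrite /dt /dd /cD.
  have -> : (fun s : R => complex.Re (u s x)) =
      (fun s : R => complex.Re (w x) + complex.Re T * s).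
    by apply/funext => s; have [_ -> _] := uE s x.
  have -> : (fun s : R => complex.Im (u s x)) =
      (fun s : R => complex.Im (w x) + complex.Im T * s).
    by apply/funext => s; have [_ _ ->] := uE s x.
  by rewrite !derive_line complex_eta.
have dpT : dd (fun s => wirtinger (fun z => lagr_density h (u s x) z (dx u s x))
    (dt u s x)) 0 = (complex.Im T / 2) +i* (complex.Re T / 2).
  rewrite /dd /cD.
  have -> : (fun s : R => complex.Re (wirtinger
      (fun z => lagr_density h (u s x) z (dx u s x)) (dt u s x))) =
      (fun s : R => complex.Im (w x) / 2 + (complex.Im T / 2) * s).
    apply/funext => s; rewrite wirtinger_lagr_ut /=; have [_ _ ->] := uE s x.
    by rewrite mulrDl; congr (_ + _); rewrite mulrAC.
  have -> : (fun s : R => complex.Im (wirtinger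
      (fun z => lagr_density h (u s x) z (dx u s x)) (dt u s x))) =
      (fun s : R => complex.Re (w x) / 2 + (complex.Re T / 2) * s).
    apply/funext => s; rewrite wirtinger_lagr_ut /=; have [_ -> _] := uE s x.
    by rewrite mulrDl; congr (_ + _); rewrite mulrAC.
  by rewrite !derive_line.
have [_] := h_pde u u_C2 0 x; rewrite duT u0 => /(_ TE)[+ _].
have -> : var_u h u 0 x =
    h_u h (w x) (dd w x) - ((complex.Im T / 2) +i* (complex.Re T / 2))
    - ((complex.Im T / 2) +i* (complex.Re T / 2))
    - dd (fun y => h_ux h (w y) (dd w y)) x.
  have sub3 (a b c a' b' c' : R[i]) :
    a = a' -> b = b' -> c = c' -> a - b - c = a' - b' - c' by move=> -> -> ->.
  have eA : wirtinger (fun z => lagr_density h z (dt u 0 x) (dx u 0 x)) (u 0 x) =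
      h_u h (w x) (dd w x) - ((complex.Im T / 2) +i* (complex.Re T / 2)).
    by rewrite wirtinger_lagr_u duT /dx u0.
  have eC : dd (fun y => wirtinger (fun z => lagr_density h (u 0 y) (dt u 0 y) z)
      (dx u 0 y)) x = dd (fun y => h_ux h (w y) (dd w y)) x.
    congr (dd _ x); apply/funext => y.
    by rewrite wirtinger_lagr_ux /dx u0.
  exact: (sub3 _ _ _ _ _ _ eA dpT eC).
move: TE; rewrite /pde_rhs -h_conj.
move: (dd (fun y => h_ux h (w y) (dd w y)) x) => X.
move: (dd (fun y => h_uxbar h (w y) (dd w y)) x) => Y.
move: (h_u h (w x) (dd w x)) => [p1 p2] TE.
case: X Y TE => x1 x2 [y1 y2].
case: (T) => t1 t2 /eqP; rewrite eq_complex /= => /andP[/eqP -> /eqP ->].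
move=> /eqP; rewrite eq_complex /= => /andP[/eqP h1 /eqP h2].
by apply/eqP; rewrite eq_complex /=; apply/andP; split; apply/eqP; lra.
Qed.

End FirstVariation.

(** * Algebraic identities *)

Section ScalarsAndCoordinates.
Context {R : realType} {n : nat}.

(** Domination of the derivatives of the momentum density by 4 G^2. *)
Lemma cross_le (a b c d e f g k r : R) : `|a| <= r -> `|b| <= r -> `|c| <= r ->
  `|d| <= r -> `|e| <= r -> `|f| <= r -> `|g| <= r -> `|k| <= r ->
  `|a * b + c * d - (e * f + g * k)| <= 4 * (r * r).
Proof.
have M (u v : R) : `|u| <= r -> `|v| <= r -> `|u * v| <= r * r.
  by move=> ur vr; rewrite normrM ler_pM.
move=> ha hb hcr hd he hf hg hk.
have h1 := M _ _ ha hb; have h2 := M _ _ hcr hd; have h3 := M _ _ he hf.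
have h4 := M _ _ hg hk.
have t1 := ler_normB (a * b + c * d) (e * f + g * k).
have t2 := ler_normD (a * b) (c * d); have t3 := ler_normD (e * f) (g * k).
lra.
Qed.

(** The left member of the inequality is the change s c + s^2 D / 2 of the error
    for a step s = - c / (D + 1) along a coordinate with partial derivative c; it is
    negative unless c = 0. *)
Lemma no_decrease (c D : R) : c != 0 -> 0 <= D ->
  0 <= - c / (D + 1) * c + 2^-1 * ((- c / (D + 1)) ^+ 2 * D) -> False.
Proof.
move=> c0 D0; have D1 : 0 < D + 1 by lra.
rewrite (_ : - c / (D + 1) * c + 2^-1 * ((- c / (D + 1)) ^+ 2 * D) =
  - ((c / (D + 1)) ^+ 2 * (D / 2 + 1))); last by field; lra.
have s0 : 0 < (c / (D + 1)) ^+ 2.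
  by rewrite exprn_even_gt0//= mulf_neq0// invr_eq0 gt_eqF.
by rewrite oppr_ge0 leNgt mulr_gt0//; lra.
Qed.

(** Here X and Y come from the momenta, S from Im M and r from h. *)
Lemma EL_algebra (X Y S r : R) : X - Y = 2 * S ->
  ((X + complex.Re (r * 2)%:C) +i* complex.Im (r * 2)%:C) - (Y +i* 0) =
  (2 * (S + r))%:C.
Proof.
move=> XY; apply/eqP; rewrite eq_complex /=; apply/andP; split; apply/eqP.
  by rewrite addrAC XY; ring.
by ring.
Qed.

Lemma addmx_coord (T : zmodType) (A B : 'cV[T]_n) k : (A + B) k 0 = A k 0 + B k 0.
Proof. by rewrite mxE. Qed.

Lemma RemxD (A B : 'cV[R[i]]_n) : Remx (A + B) = Remx A + Remx B.
Proof. by apply/colP => k; rewrite !mxE cReD. Qed.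

Lemma Im_system_coord (A : 'M[R[i]]_n) (X Y : 'cV[R[i]]_n) (v : 'cV[R]_n) k :
  (Immx A *m v) k 0 - (Immx X + Immx Y) k 0 =
  \sum_j complex.Im (A k j) * v j 0 - (complex.Im (X k 0) + complex.Im (Y k 0)).
Proof.
rewrite !mxE; congr (_ - _).
by apply: eq_bigr => j _; rewrite mxE.
Qed.

End ScalarsAndCoordinates.

(** * The ansatz as a function of position and parameters *)

Section Ansatz.
Context {R : realType} {n : nat}.
Local Notation mu := (@lebesgue_measure R).
Local Notation integ f := (mu.-integrable setT (EFin \o f)).
Variable h : R[i] -> R[i] -> R[i].
Variable uhat : 'cV[R]_n -> R -> R[i].
Variable Omega : set 'cV[R]_n.
Hypothesis h_C2 : C2_map h.
Hypothesis h_conj : forall u p, (h_u h u p)^* = h_ubar h u p.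
Hypothesis h_pde : first_variation_leads_to_pde h.
Hypothesis Omega_open : open Omega.
Hypothesis uhat_smooth : sufficiently_smooth h uhat Omega.

Local Notation V := (R * 'cV[R]_n)%type.
Local Notation dom := [set z : V | Omega z.2].
Let U (z : V) : R[i] := uhat z.2 z.1.
Let ex : V := (1, 0).
Let ek (k : 'I_n) : V := (0, Defs.basis k).

Lemma open_dom : open dom.
Proof.
apply: (@open_comp _ _ (snd : V -> 'cV[R]_n) Omega) => // z _.
exact: cvg_snd.
Qed.

Lemma U_Ck2 : cCk 2 dom U. Proof. exact: smooth_C2 uhat_smooth. Qed.

Lemma cD_Ck1 v : cCk 1 dom (cD v U).
Proof. by case: U_Ck2 => -[_ h1] [_ h2]; split; [exact: h1|exact: h2]. Qed.

(** The ansatz is of class C^2 in the joint variable (x, q), so its derivatives in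
    x and in q_k are handled as directional derivatives of one function. *)
Lemma dd_joint (f : V -> R[i]) x q : dd (fun y => f (y, q)) x = cD ex f (x, q).
Proof.
rewrite /dd /cD.
by rewrite (derive_fst (fun z : V => complex.Re (f z)))
  (derive_fst (fun z : V => complex.Im (f z))).
Qed.

Lemma uhat_xE q x : uhat_x uhat q x = cD ex U (x, q).
Proof. exact: (dd_joint U x q). Qed.

Lemma dq_joint (W : 'cV[R]_n -> R -> R[i]) k q x :
  dq k W q x = cD (ek k) (fun z : V => W z.2 z.1) (x, q).
Proof.
rewrite /dq /cD.
by rewrite (derive_snd (fun z : V => complex.Re (W z.2 z.1)))
  (derive_snd (fun z : V => complex.Im (W z.2 z.1))).
Qed.

Lemma dqE k q x : dq k uhat q x = cD (ek k) U (x, q).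
Proof. exact: dq_joint. Qed.

Lemma dq_uhat_xE k q x : dq k (uhat_x uhat) q x = cD (ek k) (cD ex U) (x, q).
Proof.
have E : (fun z : V => uhat_x uhat z.2 z.1) = cD ex U.
  by apply/funext => -[y p]; exact: uhat_xE.
exact: (etrans (dq_joint _ k q x) (congr1 (fun F => cD (ek k) F (x, q)) E)).
Qed.

Lemma dq_dqE j k q x : dq j (dq k uhat) q x = cD (ek j) (cD (ek k) U) (x, q).
Proof.
have E : (fun z : V => dq k uhat z.2 z.1) = cD (ek k) U.
  by apply/funext => -[y p]; exact: dqE.
exact: (etrans (dq_joint _ j q x) (congr1 (fun F => cD (ek j) F (x, q)) E)).
Qed.

Lemma cD_comm v w z : dom z -> cD v (cD w U) z = cD w (cD v U) z.
Proof.
move=> Dz; have [r2 i2] := U_Ck2.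
have e1 := @Ck2_derive_comm _ _ dom _ z w v open_dom r2 Dz.
have e2 := @Ck2_derive_comm _ _ dom _ z w v open_dom i2 Dz.
exact: (congr2 (@Complex R) e1 e2).
Qed.

Lemma Ck_line k (f : V -> R) q : Omega q -> Ck k dom f ->
  Ck k setT (fun x => f (x, q)).
Proof.
move=> Oq Cf.
have -> : setT = (fun x : R => (x, q)) @^-1` dom by apply/esym; rewrite -subTset => y _.
apply: (@Ck_affine_comp _ _ _ _ (fun w => (w, 0)) _ _ _ _ _ Cf).
  by move=> z; apply: differentiable_pair => //; exact: differentiable_cst.
move=> z w r.
by rewrite -[_ + r *: (w, 0)]/(z + r *: w, q + r *: 0) scaler0 addr0.
Qed.

Lemma cCk_line k (f : V -> R[i]) q : Omega q -> cCk k dom f ->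
  cCk k setT (fun x => f (x, q)).
Proof. by move=> Oq [f1 f2]; exact: (conj (Ck_line Oq f1) (Ck_line Oq f2)). Qed.

Lemma uhat_Ck2 q : Omega q -> cCk 2 setT (uhat q).
Proof. by move=> Oq; exact: cCk_line Oq U_Ck2. Qed.

Lemma uhat_Ck1 q : Omega q -> cCk 1 setT (uhat q).
Proof. by move=> /uhat_Ck2[u1 u2]; split; exact: Ck2_Ck1. Qed.

Lemma uhat_x_Ck1 q : Omega q -> cCk 1 setT (uhat_x uhat q).
Proof.
move=> Oq; have -> : uhat_x uhat q = (fun x => cD ex U (x, q)).
  by apply/funext => x; exact: uhat_xE.
exact: cCk_line Oq (cD_Ck1 ex).
Qed.

Lemma dq_Ck1 k q : Omega q -> cCk 1 setT (dq k uhat q).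
Proof.
move=> Oq; have -> : dq k uhat q = (fun x => cD (ek k) U (x, q)).
  by apply/funext => x; exact: dqE.
exact: cCk_line Oq (cD_Ck1 (ek k)).
Qed.

(** Symmetry of second derivatives, for x and q_k. *)
Lemma dd_dq k q x : Omega q -> dd (dq k uhat q) x = dq k (uhat_x uhat) q x.
Proof.
move=> Oq; have E : dq k uhat q = (fun x => cD (ek k) U (x, q)).
  by apply/funext => y; exact: dqE.
have Dz : dom (x, q) by [].
rewrite E; apply: (etrans (dd_joint _ x q)).
exact: (etrans (cD_comm ex (ek k) Dz) (esym (dq_uhat_xE k q x))).
Qed.

Lemma dq_inH k q : Omega q -> inH (dq k uhat q).
Proof.
move=> Oq; have [G G2 near_q] := smooth_dominated uhat_smooth Oq.
apply: (dominated_inH (dq_Ck1 k Oq) G2) => x.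
by have [_ + _] := nbhs_singleton near_q x; exact.
Qed.

Lemma uhat_inH q : Omega q -> inH (uhat q).
Proof. exact: (smooth_inH uhat_smooth). Qed.

Lemma rhs_inH q : Omega q -> inH (pde_rhs h (uhat q)).
Proof. exact: (smooth_rhs_inH uhat_smooth). Qed.

Let hu q x := h_u h (uhat q x) (uhat_x uhat q x).
Let hux q x := h_ux h (uhat q x) (uhat_x uhat q x).
Let huxbar q x := h_uxbar h (uhat q x) (uhat_x uhat q x).

(** * The vector f of RONS *)

(** The only place where the real part uses the variational hypothesis: after
    conjugation F contains ((h_pbar)_x)^*, which is replaced by (h_p)_x so that a
    total derivative can be split off. *)
Lemma rons_f_integrand k q x : Omega q ->
  dq k uhat q x * (pde_rhs h (uhat q) x)^* =
  - 'i%C * (dq k uhat q x * hu q x + dq k (uhat_x uhat) q x * hux q x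
            - dd (fun y => dq k uhat q y * hux q y) x).
Proof.
move=> Oq.
have [hux1 _] := h_ux_along_Ck1 h_C2 (uhat_Ck1 Oq) (uhat_x_Ck1 Oq).
have [_ ->] := cCk1M (dq_Ck1 k Oq) hux1.
rewrite dd_dq// (conj_dd_h_ux h_C2 h_conj x h_pde (uhat_Ck2 Oq)).
rewrite /pde_rhs -h_conj -/(hu q x) -/(hux q x).
move: (dd (fun y => h_uxbar h (uhat q y) (dd (uhat q) y)) x) => [y1 y2].
move: (dq k uhat q x) (dq k (uhat_x uhat) q x) (hu q x) (hux q x).
move=> [a1 a2] [b1 b2] [c1 c2] [d1 d2].
by apply/eqP; rewrite eq_complex /=; apply/andP; split; apply/eqP; ring.
Qed.

Lemma rons_f_coord q k : rons_f h uhat q k 0 =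
  cint (fun x => dq k uhat q x * (pde_rhs h (uhat q) x)^*).
Proof. by rewrite /rons_f mxE. Qed.

Lemma xi_coord q k : xi h uhat q k 0 =
  - 'i%C * cint (fun x => dq k uhat q x * hu q x).
Proof. by rewrite /xi mxE. Qed.

Lemma eta_coord q k : eta h uhat q k 0 =
  - 'i%C * cint (fun x => dq k (uhat_x uhat) q x * hux q x).
Proof. by rewrite /eta mxE. Qed.

(** The total derivative of rons_f_integrand is integrable, being a combination of
    the integrands of f, xi and eta, and its primitive vanishes at both ends. *)
Lemma rons_fE q : Omega q -> rons_f h uhat q = xi h uhat q + eta h uhat q.
Proof.
move=> Oq; apply/colP => k.
apply: (etrans (rons_f_coord q k)).
apply: etrans (esym (addmx_coord (xi h uhat q) (eta h uhat q) k)).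
apply: etrans (esym (congr2 +%R (xi_coord q k) (eta_coord q k))).
have iA := smooth_xi_integrable uhat_smooth k Oq.
have iB := smooth_eta_integrable uhat_smooth k Oq.
have iF := mul_conj_cintegrable (dq_inH k Oq) (rhs_inH Oq).
have [iAB eAB] := cintD iA iB.
have [iF' eF'] := cintZ (- 'i%C) iF.
have [iY eY] := cintD iAB iF'.
pose Y x := dd (fun y => dq k uhat q y * hux q y) x.
have EY : (fun x => dq k uhat q x * hu q x + dq k (uhat_x uhat) q x * hux q x
    + - 'i%C * (dq k uhat q x * (pde_rhs h (uhat q) x)^*)) = Y.
  apply/funext => x; rewrite rons_f_integrand// -/(Y x).
  move: (dq k uhat q x * hu q x) (dq k (uhat_x uhat) q x * hux q x) (Y x).
  move=> [a1 a2] [b1 b2] [c1 c2].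
  by apply/eqP; rewrite eq_complex /=; apply/andP; split; apply/eqP; ring.
have Y0 : cint Y = 0.
  have [b1 b2] := smooth_boundary uhat_smooth k Oq.
  have [hux1 _] := h_ux_along_Ck1 h_C2 (uhat_Ck1 Oq) (uhat_x_Ck1 Oq).
  have [F1 _] := cCk1M (dq_Ck1 k Oq) hux1.
  apply: (cint_dd_eq0 F1 _ (cvg0_small_at_ends b1 b2)).
    by move: iY; rewrite -/(hu q) EY.
  by move=> x; rewrite normc_def.
move: eY; rewrite EY Y0 eAB eF'.
move=> /esym; exact: solve_mulNi.
Qed.

(** * The RONS error as a quadratic polynomial *)

Lemma metric_coord q k j : metric uhat q k j = inner (dq k uhat q) (dq j uhat q).
Proof. by rewrite /metric mxE. Qed.

Lemma uhat_t_inH q v : Omega q -> inH (uhat_t uhat q v).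
Proof.
by move=> Oq; apply: inH_sum => j; apply: inHZ; exact: dq_inH.
Qed.

Lemma residual_inH q v : Omega q ->
  inH (fun x => uhat_t uhat q v x - pde_rhs h (uhat q) x).
Proof.
move=> Oq; have := inHD (uhat_t_inH v Oq) (inHZ (-1) (rhs_inH Oq)).
congr inH; apply/funext => x; congr (_ + _).
by rewrite rmorphN1 mulrN1.
Qed.

(** The partial derivative of the RONS error with respect to the k-th velocity. *)
Definition Re_residual (q v : 'cV[R]_n) (k : 'I_n) : R :=
  \sum_j complex.Re (metric uhat q k j) * v j 0
  - complex.Re (rons_f h uhat q k 0).

Lemma inner_dq_residual q v k : Omega q ->
  complex.Re (inner (dq k uhat q)
    (fun x => uhat_t uhat q v x - pde_rhs h (uhat q) x)) = Re_residual q v k.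
Proof.
move=> Oq.
have hk := dq_inH k Oq; have ht := uhat_t_inH v Oq; have hF := rhs_inH Oq.
have E : (fun x => uhat_t uhat q v x - pde_rhs h (uhat q) x) =
         (fun x => uhat_t uhat q v x + pde_rhs h (uhat q) x * (-1)%:C).
  by apply/funext => x; rewrite rmorphN1 mulrN1.
rewrite E (innerDr hk ht (inHZ (-1) hF)) cReD; congr (_ + _).
  transitivity (complex.Re (inner (uhat_t uhat q v) (dq k uhat q))).
    exact: (etrans (congr1 (@complex.Re R) (inner_conj ht hk)) (cRe_conj _)).
  rewrite [inner _ _](inner_suml v (fun j => dq_inH j Oq) hk).
  rewrite cRe_sum; apply: eq_bigr => j _.
  by rewrite cReZ metric_coord (inner_conj (dq_inH j Oq) hk) cRe_conj mulrC.
rewrite rons_f_coord /inner.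
have -> : (fun x => dq k uhat q x * (pde_rhs h (uhat q) x * (-1)%:C)^*) =
          (fun x => (-1)%:C * (dq k uhat q x * (pde_rhs h (uhat q) x)^*)).
  apply/funext => x; move: (dq k uhat q x) (pde_rhs h (uhat q) x).
  move=> [a b] [c d].
  by apply/eqP; rewrite eq_complex /=; apply/andP; split; apply/eqP; ring.
have [_ ->] := cintZ (-1)%:C (mul_conj_cintegrable hk hF).
by rewrite cReZ mulN1r.
Qed.

(** The increment of the residual is linear in d, so the squared norm has no term
    beyond second order. *)
Lemma rons_error_expand q v d : Omega q ->
  rons_error h uhat q (v + d) = rons_error h uhat q v
  + \sum_k d k 0 * Re_residual q v k + 2^-1 * normH (uhat_t uhat q d) ^+ 2.
Proof.
move=> Oq; rewrite /rons_error.
pose r v := fun x => uhat_t uhat q v x - pde_rhs h (uhat q) x.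
have hr w : inH (r w) := residual_inH w Oq.
have hd := uhat_t_inH d Oq.
have -> : (fun x => uhat_t uhat q (v + d) x - pde_rhs h (uhat q) x) =
    (fun x => r v x + uhat_t uhat q d x).
  apply/funext => x; rewrite /r addrAC; congr (_ - _).
  rewrite /uhat_t -big_split /=; apply: eq_bigr => j _.
  by rewrite -mulrDr -rmorphD mxE.
rewrite -(inner_self (r v)) -(inner_self (uhat_t uhat q d)).
rewrite -(inner_self (fun x => r v x + uhat_t uhat q d x)).
rewrite (innerDl (hr v) hd (inHD (hr v) hd)) (innerDr (hr v) (hr v) hd).
rewrite (innerDr hd (hr v) hd) (inner_conj hd (hr v)).
have -> : \sum_k d k 0 * Re_residual q v k =
    complex.Re (inner (uhat_t uhat q d) (r v)).
  rewrite [inner _ _](inner_suml d (fun j => dq_inH j Oq) (hr v)) cRe_sum.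
  by apply: eq_bigr => k _; rewrite cReZ -(inner_dq_residual v k Oq).
move: (inner (r v) (r v)) (inner (uhat_t uhat q d) (r v)).
move: (inner (uhat_t uhat q d) (uhat_t uhat q d)) => [a1 a2] [b1 b2] [c1 c2] /=.
by field.
Qed.

Lemma master_Re_residual q v : Omega q ->
  master_Re h uhat q v <-> forall k, Re_residual q v k = 0.
Proof.
move=> Oq; have E k : Re_residual q v k =
    (Remx (metric uhat q) *m v) k 0 - (Remx (xi h uhat q) + Remx (eta h uhat q)) k 0.
  rewrite /Re_residual rons_fE//; congr (_ - _).
    by rewrite mxE; apply: eq_bigr => j _; rewrite [in RHS]mxE.
  rewrite addmx_coord cReD.
  apply: esym; apply: (etrans (addmx_coord _ _ k)).
  by congr (_ + _); rewrite /Remx mxE.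
split=> [H k|H]; first by rewrite E H subrr.
by apply/colP => k; apply/eqP; rewrite -subr_eq0 -E H.
Qed.

(** If the residual vanishes, the expansion of the error leaves a nonnegative
    increment.  If its k-th entry does not, a small step in that direction
    decreases the error. *)
Lemma master_Re_minimizer q v : Omega q ->
  master_Re h uhat q v <-> rons_minimizer h uhat q v.
Proof.
move=> Oq; rewrite master_Re_residual//; split=> [g0 w|Hmin k].
  rewrite -(subrK v w) addrC rons_error_expand// big1 ?addr0; last first.
    by move=> k _; rewrite g0 mulr0.
  by rewrite lerDl mulr_ge0// sqr_ge0.
pose c := Re_residual q v k.
(* The step s is short enough for the quadratic term to stay below the linear
   one; adding 1 to D avoids a division by 0. *)
have [c0//|c0] := eqVneq c 0.
pose D := normH (uhat_t uhat q (Defs.basis k)) ^+ 2.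
have D0 : 0 <= D by rewrite sqr_ge0.
pose s := - c / (D + 1).
have := Hmin (v + s *: Defs.basis k).
rewrite rons_error_expand// -addrA lerDl.
have -> : \sum_j (s *: Defs.basis k) j 0 * Re_residual q v j = s * c.
  rewrite (bigD1 k)//= big1 ?addr0.
    by rewrite !mxE !eqxx mulr1.
  by move=> j /negbTE jk; rewrite !mxE jk mulr0 mul0r.
have -> : normH (uhat_t uhat q (s *: Defs.basis k)) ^+ 2 = s ^+ 2 * D.
  rewrite -inner_self /D -(inner_self (uhat_t uhat q (Defs.basis k))) -cReZ.
  have ii := uhat_t_inH (Defs.basis k) Oq.
  have [_ <-] := cintZ (s ^+ 2)%:C (mul_conj_cintegrable ii ii).
  congr (complex.Re (cint _)); apply/funext => x.
  have -> : uhat_t uhat q (s *: Defs.basis k) x =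
      s%:C * uhat_t uhat q (Defs.basis k) x.
    rewrite /uhat_t mulr_sumr; apply: eq_bigr => j _.
    by rewrite mxE rmorphM mulrCA.
  case: (uhat_t uhat q (Defs.basis k) x) => a b.
  by apply/eqP; rewrite eq_complex /=; apply/andP; split; apply/eqP; ring.
by move=> /(no_decrease c0 D0).
Qed.

(** For a real vector z the Hermitian form of M has real part z^T (Re M) z, so
    Re M has trivial kernel. *)
Lemma Re_metric_unit q : hermitian_posdef (metric uhat q) ->
  Remx (metric uhat q) \in unitmx.
Proof.
move=> [_ pos]; rewrite -row_free_unit -kermx_eq0; apply/rowV0P => u.
move=> /sub_kermxP uA; apply/eqP; apply: contraT => u0.
pose z : 'cV[R[i]]_n := \col_j (u 0 j)%:C.
have z0 : z != 0.
  apply: contra u0 => /eqP z0; apply/eqP/rowP => j.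
  by move/colP/(_ j) : z0; rewrite !mxE => -[].
have := pos z z0; rewrite ltcE => /andP[_].
have -> : complex.Re (\sum_k \sum_j (z k 0)^* * metric uhat q k j * z j 0) =
    (u *m Remx (metric uhat q) *m u^T) 0 0.
  rewrite mxE cRe_sum; under eq_bigr => k _ do rewrite cRe_sum.
  rewrite exchange_big; apply: eq_bigr => j _.
  rewrite [X in _ = X * _]mxE mulr_suml; apply: eq_bigr => k _.
  have zE i : z i 0 = (u 0 i)%:C by rewrite mxE.
  have tE : u^T j 0 = u 0 j by rewrite mxE.
  have rE : Remx (metric uhat q) k j = complex.Re (metric uhat q k j).
    by rewrite [LHS]mxE.
  rewrite !zE tE rE.
  by case: (metric uhat q k j) => a b /=; ring.
by rewrite uA mul0mx mxE ltxx.
Qed.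

Lemma master_Re_equation q v : Omega q -> hermitian_posdef (metric uhat q) ->
  master_Re h uhat q v <-> rons_equation h uhat q v.
Proof.
move=> Oq /Re_metric_unit uM; rewrite /master_Re /rons_equation rons_fE//.
rewrite RemxD; move: (Remx (metric uhat q)) uM => A uA.
by split=> [<-|->]; rewrite ?mulKmx ?mulKVmx.
Qed.

(** * The reduced Lagrangian and its derivatives *)

Let h_along q x := h (uhat q x) (uhat_x uhat q x).

(** Minus the imaginary part of u_k u^* , whose integral over x is the momentum
    conjugate to q_k. *)
Definition momentum_density (k : 'I_n) (q : 'cV[R]_n) (x : R) : R :=
  complex.Re (dq k uhat q x) * complex.Im (uhat q x)
  - complex.Im (dq k uhat q x) * complex.Re (uhat q x).

Definition canonical_momentum (k : 'I_n) (q : 'cV[R]_n) : R :=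
  \int[mu]_x momentum_density k q x.

Lemma momentum_density_integ k q : Omega q -> integ (momentum_density k q).
Proof.
move=> Oq; have [k1 k2] := dq_inH k Oq; have [u1 u2] := uhat_inH Oq.
have := (integ_lincomb 1 (-1) (Lfun2_mul_integ k1 u2) (Lfun2_mul_integ k2 u1)).1.
congr (is_true (integrable _ _ (EFin \o _))); apply/funext => x.
by rewrite mul1r mulN1r.
Qed.

Lemma h_along_cintegrable q : Omega q -> cintegrable (h_along q).
Proof. exact: (smooth_h_integrable uhat_smooth). Qed.

(** Affine in the velocity, because the kinetic part of the density is linear in
    u_t and h contains no u_t. *)
Lemma reduced_lagrangianE q v : Omega q ->
  reduced_lagrangian h uhat q v =
  \sum_j (v j 0)%:C * (canonical_momentum j q)%:C + cint (h_along q).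
Proof.
move=> Oq.
have iD j := cint_real (momentum_density_integ j Oq).
have iZ j := cintZ (v j 0)%:C (iD j).1.
have iS := cint_sum (fun j => (iZ j).1).
have [_ E] := cintD iS.1 (h_along_cintegrable Oq).
have -> : \sum_j (v j 0)%:C * (canonical_momentum j q)%:C =
    \sum_j cint (fun x => (v j 0)%:C * (momentum_density j q x)%:C).
  by apply: eq_bigr => j _; rewrite (iZ j).2 (iD j).2.
rewrite -iS.2 -E /reduced_lagrangian; congr cint; apply/funext => x.
rewrite lagr_densityE; congr (_ + _).
rewrite /uhat_t cRe_sum cIm_sum !mulr_suml -sumrB raddf_sum.
apply: eq_bigr => j _; rewrite /momentum_density.
move: (dq j uhat q x) (uhat q x) => [a b] [c d] /=.
by apply/eqP; rewrite eq_complex /=; apply/andP; split; apply/eqP; ring.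
Qed.

Lemma near_Omega q : Omega q -> \forall p \near q, Omega p.
Proof. by move=> Oq; exact: open_nbhs_nbhs. Qed.

Lemma slice_differentiable (f : V -> R) x q :
  differentiable f (x, q) -> differentiable (fun p => f (x, p)) q.
Proof.
by move=> df; apply: (@differentiable_comp _ _ _ _ (fun p => (x, p)) f).
Qed.

Lemma uhat_differentiable x q : Omega q ->
  differentiable (fun p => complex.Re (uhat p x)) q /\
  differentiable (fun p => complex.Im (uhat p x)) q.
Proof.
move=> Oq; have [[d1 _] [d2 _]] := U_Ck2; have Dz : dom (x, q) by [].
by split; [exact: (slice_differentiable (d1 _ Dz))|
           exact: (slice_differentiable (d2 _ Dz))].
Qed.

Lemma dq_differentiable k x q : Omega q ->
  differentiable (fun p => complex.Re (dq k uhat p x)) q /\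
  differentiable (fun p => complex.Im (dq k uhat p x)) q.
Proof.
move=> Oq; have [[d1 _] [d2 _]] := cD_Ck1 (ek k); have Dz : dom (x, q) by [].
have E : (fun p => dq k uhat p x) = (fun p => cD (ek k) U (x, p)).
  by apply/funext => p; exact: dqE.
have E1 := congr1 (fun F p => complex.Re (F p)) E.
have E2 := congr1 (fun F p => complex.Im (F p)) E.
rewrite /= in E1 E2; rewrite E1 E2.
by split; [exact: (slice_differentiable (d1 _ Dz))|
           exact: (slice_differentiable (d2 _ Dz))].
Qed.

Lemma uhat_x_differentiable x q : Omega q ->
  differentiable (fun p => complex.Re (uhat_x uhat p x)) q /\
  differentiable (fun p => complex.Im (uhat_x uhat p x)) q.
Proof.
move=> Oq; have [[d1 _] [d2 _]] := cD_Ck1 ex; have Dz : dom (x, q) by [].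
have E : (fun p => uhat_x uhat p x) = (fun p => cD ex U (x, p)).
  by apply/funext => p; exact: uhat_xE.
have E1 := congr1 (fun F p => complex.Re (F p)) E.
have E2 := congr1 (fun F p => complex.Im (F p)) E.
rewrite /= in E1 E2; rewrite E1 E2.
by split; [exact: (slice_differentiable (d1 _ Dz))|
           exact: (slice_differentiable (d2 _ Dz))].
Qed.

Lemma dq_dq_comm j k q x : Omega q -> dq j (dq k uhat) q x = dq k (dq j uhat) q x.
Proof.
move=> Oq; have Dz : dom (x, q) by [].
exact: (etrans (dq_dqE j k q x) (etrans (cD_comm _ _ Dz) (esym (dq_dqE k j q x)))).
Qed.

Lemma momentum_density_derive j k q x : Omega q ->
  differentiable ((momentum_density k) ^~ x) q /\
  'D_(Defs.basis j) ((momentum_density k) ^~ x) q =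
  complex.Re (dq k uhat q x) * complex.Im (dq j uhat q x)
  + complex.Im (uhat q x) * complex.Re (dq j (dq k uhat) q x)
  - (complex.Im (dq k uhat q x) * complex.Re (dq j uhat q x)
     + complex.Re (uhat q x) * complex.Im (dq j (dq k uhat) q x)).
Proof.
move=> Oq; have [k1 k2] := dq_differentiable k x Oq.
have [u1 u2] := uhat_differentiable x Oq.
exact: (derive_cross (Defs.basis j) k1 u2 k2 u1).
Qed.

Lemma momentum_density_dominated k q : Omega q -> exists2 g : R -> R, integ g &
  (\forall p \near q, integ (momentum_density k p)) /\
  (\forall p \near q, forall x, differentiable ((momentum_density k) ^~ x) p /\
    forall j, `|'D_(Defs.basis j) ((momentum_density k) ^~ x) p| <= g x).
Proof.
move=> Oq; have [G G2 Gdom] := smooth_dominated uhat_smooth Oq.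
exists (fun x => 4 * (G x * G x)).
  have := (integ_lincomb 4 0 (Lfun2_mul_integ G2 G2) (Lfun2_mul_integ G2 G2)).1.
  congr (is_true (integrable _ _ (EFin \o _))); apply/funext => x.
  by rewrite mul0r addr0.
split; first by apply: filterS (near_Omega Oq) => p; exact: momentum_density_integ.
apply: filterS2 (near_Omega Oq) Gdom => p Op Gp x.
split=> [|j].
  have [k1 k2] := dq_differentiable k x Op.
  have [u1 u2] := uhat_differentiable x Op.
  exact: (derive_cross 0 k1 u2 k2 u1).1.
have [_ ->] := momentum_density_derive j k x Op.
have [Gu Gk Gjk] := Gp x.
have [ur ui] := norm_parts_le Gu; have [kr ki] := norm_parts_le (Gk k).
have [jr ji] := norm_parts_le (Gk j); have [jkr jki] := norm_parts_le (Gjk k j).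
exact: cross_le.
Qed.

Lemma canonical_momentum_partial j k q : Omega q ->
  integ (fun x => 'D_(Defs.basis k) ((momentum_density j) ^~ x) q) /\
  is_derive q (Defs.basis k) (canonical_momentum j)
    (\int[mu]_x 'D_(Defs.basis k) ((momentum_density j) ^~ x) q).
Proof.
move=> Oq; have [g ig [n1 n2]] := momentum_density_dominated j Oq.
exact: (derive_under_integral_dir (Defs.basis k) ig n1 n2).
Qed.

Lemma canonical_momentum_derive k (gamma : R -> 'cV[R]_n) (t : R) :
  Omega (gamma t) -> derivable gamma t 1 ->
  is_derive t 1 (fun s => canonical_momentum k (gamma s)) (\sum_j ('D_1 gamma t) j 0 *
    \int[mu]_x 'D_(Defs.basis j) ((momentum_density k) ^~ x) (gamma t)).
Proof.
move=> Oq dg; have [g ig [n1 n2]] := momentum_density_dominated k Oq.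
have [_ D] := derive_under_integral ig n1 n2 dg.
rewrite -Rintegral_lincomb; last by move=> j; exact: (canonical_momentum_partial k j Oq).1.
suff -> : (fun x => \sum_j ('D_1 gamma t) j 0 *
    'D_(Defs.basis j) ((momentum_density k) ^~ x) (gamma t)) =
  (fun x => 'D_('D_1 gamma t) ((momentum_density k) ^~ x) (gamma t)) by [].
apply/funext => x; rewrite derive_sum_basis//.
by have [] := nbhs_singleton n2 x.
Qed.

Lemma dq_h_alongE k q x : Omega q ->
  [/\ differentiable (fun p => complex.Re (h_along p x)) q,
      differentiable (fun p => complex.Im (h_along p x)) q &
  dq k h_along q x = dq k uhat q x * hu q x + (dq k uhat q x)^* * (hu q x)^*
  + dq k (uhat_x uhat) q x * hux q x + (dq k (uhat_x uhat) q x)^* * huxbar q x].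
Proof.
move=> Oq; have [u1 u2] := uhat_differentiable x Oq.
have [p1 p2] := uhat_x_differentiable x Oq.
have [h1 h2 E] := @chain_rule _ h h_C2 _ (fun p => uhat p x)
  (fun p => uhat_x uhat p x) q (Defs.basis k) u1 u2 p1 p2.
split=> //; apply: (etrans E).
by rewrite -h_conj.
Qed.

(** The derivative of h along the ansatz is dominated as a whole, so the integral
    of h is differentiated before the chain rule is applied to the integrand. *)
Lemma h_along_derive k q : Omega q ->
  [/\ cintegrable (dq k h_along q),
      is_derive q (Defs.basis k) (fun p => complex.Re (cint (h_along p)))
        (complex.Re (cint (dq k h_along q))) &
      is_derive q (Defs.basis k) (fun p => complex.Im (cint (h_along p)))
        (complex.Im (cint (dq k h_along q)))].
Proof.
move=> Oq; have [g ig gdom] := smooth_h_dominated uhat_smooth Oq.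
have n1 : \forall p \near q, integ (fun x => complex.Re (h_along p x)).
  by apply: filterS (near_Omega Oq) => p /h_along_cintegrable[].
have n2 : \forall p \near q, integ (fun x => complex.Im (h_along p x)).
  by apply: filterS (near_Omega Oq) => p /h_along_cintegrable[].
have n3 : \forall p \near q, forall x,
    differentiable (fun y => complex.Re (h_along y x)) p /\
    forall j, `|'D_(Defs.basis j) (fun y => complex.Re (h_along y x)) p| <= g x.
  apply: filterS2 (near_Omega Oq) gdom => p Op gp x; split=> [|j].
    by have [] := dq_h_alongE k x Op.
  by have [] := norm_parts_le (gp x j).
have n4 : \forall p \near q, forall x,
    differentiable (fun y => complex.Im (h_along y x)) p /\
    forall j, `|'D_(Defs.basis j) (fun y => complex.Im (h_along y x)) p| <= g x.
  apply: filterS2 (near_Omega Oq) gdom => p Op gp x; split=> [|j].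
    by have [] := dq_h_alongE k x Op.
  by have [] := norm_parts_le (gp x j).
have [i1 d1] := @derive_under_integral_dir _ _
  (fun p x => complex.Re (h_along p x)) g q (Defs.basis k) ig n1 n3.
have [i2 d2] := @derive_under_integral_dir _ _
  (fun p x => complex.Im (h_along p x)) g q (Defs.basis k) ig n2 n4.
exact: (And3 (conj i1 i2) d1 d2).
Qed.

(** By conj_dd_h_ux both functions of x have the same derivative.  The constant
    need not be 0, for instance when Im h is a linear form in u_x. *)
Lemma h_uxbar_defect q : Omega q ->
  exists c : R[i], forall x, huxbar q x = (hux q x)^* + c.
Proof.
move=> Oq; have [u1 ub1] := h_ux_along_Ck1 h_C2 (uhat_Ck1 Oq) (uhat_x_Ck1 Oq).
have [uc1 ducE] := cCk1_conj u1.
have ddE x : dd (huxbar q) x = dd (fun x => (hux q x)^*) x.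
  apply: esym; apply: (etrans (ducE x)).
  have e := congr1 (fun z => z^*) (conj_dd_h_ux h_C2 h_conj x h_pde (uhat_Ck2 Oq)).
  have conjK (z : R[i]) : z^*^* = z by case: z => a b;
    apply/eqP; rewrite eq_complex /=; apply/andP; split; apply/eqP; ring.
  exact: (etrans e (conjK _)).
exists (huxbar q 0 - (hux q 0)^*) => x.
exact: (same_dd_defect ub1 uc1 ddE).
Qed.

(** By the chain rule and (h_u)^* = h_ubar, the integrand is A + B plus its
    conjugate, where A = u_k h_u and B = u_kx h_p, plus the constant of
    h_uxbar_defect times (u_kx)^*.  The last term is integrable by difference, and
    it is the derivative of a square-integrable function, so its integral is 0. *)
Lemma cint_dq_h_along k q : Omega q ->
  cint (dq k h_along q) =
  ((complex.Re (cint (fun x => dq k uhat q x * hu q x))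
   + complex.Re (cint (fun x => dq k (uhat_x uhat) q x * hux q x))) * 2)%:C.
Proof.
move=> Oq; have [iH _ _] := h_along_derive k Oq.
have iA := smooth_xi_integrable uhat_smooth k Oq.
have iB := smooth_eta_integrable uhat_smooth k Oq.
have [c cE] := h_uxbar_defect Oq.
pose A x := dq k uhat q x * hu q x.
pose B x := dq k (uhat_x uhat) q x * hux q x.
have iAB : cintegrable (fun x => A x + B x) := (cintD iA iB).1.
have iABc := (cint_conj iAB).1.
have [iAA eAA] := cintD iAB iABc.
have eAB : cint (fun x => A x + B x) = cint A + cint B := (cintD iA iB).2.
have eABc := (cint_conj iAB).2.
(* Z is the contribution of the constant c = h_pbar - (h_p)^* . *)
have [k1 dkE] := cCk1_conj (dq_Ck1 k Oq).
pose Z x := c * (dq k (uhat_x uhat) q x)^*.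
have HE : dq k h_along q = (fun x => (A x + B x) + (A x + B x)^* + Z x).
  apply/funext => x; have [_ _ ->] := dq_h_alongE k x Oq.
  rewrite cE /A /B /Z.
  move: (dq k uhat q x) (dq k (uhat_x uhat) q x) (hu q x) (hux q x).
  move=> [a1 a2] [b1 b2] [c1 c2] [d1 d2]; case: (c) => z1 z2.
  by apply/eqP; rewrite eq_complex /=; apply/andP; split; apply/eqP; ring.
have [iAAn _] := cintZ (-1) iAA.
have iZ : cintegrable Z.
  have [iz _] := cintD iH iAAn; move: iz; congr cintegrable.
  by apply/funext => x; rewrite HE mulN1r addrAC subrr add0r.
have cst1 : cCk 1 setT (fun _ : R => c).
  by split; exact: Ck_cst.
have [F1 dF] := cCk1M cst1 k1.
have ZE : Z = (fun x => dd (fun y => c * (dq k uhat q y)^*) x).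
  apply/funext => x; rewrite dF dkE dd_dq//.
  have -> : dd (fun _ : R => c) x = 0.
    by rewrite /dd /cD !derive_cst.
  by rewrite mul0r add0r.
have Z0 : cint Z = 0.
  have [G G2 near_q] := smooth_dominated uhat_smooth Oq.
  have Gk x : `|dq k uhat q x| <= (G x)%:C.
    by have [_ + _] := nbhs_singleton near_q x; exact.
  have sG : small_at_ends G.
    apply: (Lfun2_small_at_ends G2) => x; rewrite ger0_norm//.
    have [+ _] := norm_parts_le (Gk x); exact: le_trans.
  have [r rE] : exists r : R, `|c| = r%:C by eexists; exact: normc_def.
  rewrite ZE; apply: (cint_dd_eq0 F1 _ (small_at_endsZ r sG)).
    by rewrite -ZE.
  move=> x; have -> : `|c * (dq k uhat q x)^*| = `|c| * `|dq k uhat q x|.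
    by rewrite normrM; congr (_ * _); case: (dq k uhat q x) => a b;
      rewrite !normc_def /= sqrrN.
  by rewrite rE rmorphM ler_pM// -rE.
have [_ eH] := cintD iAA iZ.
rewrite HE eH Z0 addr0 eAA eABc eAB.
exact: add_conj_real.
Qed.

(** The terms with second derivatives of the ansatz cancel by symmetry. *)
Lemma curl_canonical_momentum j k q : Omega q ->
  \int[mu]_x 'D_(Defs.basis k) ((momentum_density j) ^~ x) q
  - \int[mu]_x 'D_(Defs.basis j) ((momentum_density k) ^~ x) q
  = 2 * complex.Im (metric uhat q k j).
Proof.
move=> Oq; have [i1 _] := canonical_momentum_partial j k Oq.
have [i2 _] := canonical_momentum_partial k j Oq.
have [i3 i4] := mul_conj_cintegrable (dq_inH k Oq) (dq_inH j Oq).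
have M : complex.Im (metric uhat q k j) =
    \int[mu]_x complex.Im (dq k uhat q x * (dq j uhat q x)^*).
  by rewrite metric_coord.
have EB := RintegralB measurableT i1 i2.
have EZ := @RintegralZl _ _ _ mu _ _ 2 measurableT i4.
rewrite M -EZ -EB; congr (Rintegral _ _ _); apply/funext => x.
have [_ ->] := momentum_density_derive k j x Oq.
have [_ ->] := momentum_density_derive j k x Oq.
rewrite (dq_dq_comm j k x Oq) mulcJ.
move: (dq k (dq j uhat) q x) (dq k uhat q x) (dq j uhat q x) (uhat q x).
by move=> [a1 a2] [b1 b2] [c1 c2] [d1 d2] /=; ring.
Qed.

Lemma reduced_lagrangian_position k q v : Omega q ->
  is_derive q (Defs.basis k) (fun p => complex.Re (reduced_lagrangian h uhat p v))
    (\sum_j v j 0 * \int[mu]_x 'D_(Defs.basis k) ((momentum_density j) ^~ x) q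
     + complex.Re (cint (dq k h_along q))) /\
  is_derive q (Defs.basis k) (fun p => complex.Im (reduced_lagrangian h uhat p v))
    (complex.Im (cint (dq k h_along q))).
Proof.
move=> Oq; have [_ dR dI] := h_along_derive k Oq; split.
  pose F : 'cV[R]_n -> R := \sum_(j < n) (v j 0 \*: canonical_momentum j).
  have dF : is_derive q (Defs.basis k) F
      (\sum_j v j 0 * \int[mu]_x 'D_(Defs.basis k) ((momentum_density j) ^~ x) q).
    have dj j := is_deriveZ (v j 0) (canonical_momentum_partial j k Oq).2.
    exact: (is_derive_sum dj).
  apply: near_eq_is_derive (is_deriveD dF dR).
  apply: filterS (near_Omega Oq) => p Op; rewrite reduced_lagrangianE//.
  rewrite cReD cRe_sum fctE; congr (_ + _).
  rewrite /F fct_sumE; apply: eq_bigr => j _.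
  by rewrite cReZ.
apply: near_eq_is_derive dI.
apply: filterS (near_Omega Oq) => p Op; rewrite reduced_lagrangianE//.
rewrite cImD cIm_sum big1 ?add0r// => j _.
by rewrite cImZ mulr0.
Qed.

(** The reduced Lagrangian is affine in the velocity by reduced_lagrangianE, so
    that no integral has to be differentiated here. *)
Lemma reduced_lagrangian_velocity k q v : Omega q ->
  is_derive v (Defs.basis k)
    (fun w => complex.Re (reduced_lagrangian h uhat q w)) (canonical_momentum k q) /\
  is_derive v (Defs.basis k) (fun w => complex.Im (reduced_lagrangian h uhat q w)) 0.
Proof.
move=> Oq; have E r : reduced_lagrangian h uhat q (v + r *: Defs.basis k) =
    reduced_lagrangian h uhat q v + (r * canonical_momentum k q)%:C.
  rewrite !reduced_lagrangianE// [RHS]addrAC; congr (_ + _).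
  have -> : (r * canonical_momentum k q)%:C =
      \sum_j ((r *: Defs.basis k : 'cV[R]_n) j 0)%:C * (canonical_momentum j q)%:C.
    rewrite (bigD1 k)//= big1 ?addr0.
      by rewrite !mxE !eqxx mulr1 rmorphM.
    by move=> j /negbTE jk; rewrite !mxE jk mulr0 mul0r.
  rewrite -big_split; apply: eq_bigr => j _.
  by apply: etrans (mulrDl _ _ _); rewrite -rmorphD mxE.
split; apply: is_derive_affine => r; rewrite E.
  by rewrite cReD.
by rewrite cImD mulr0.
Qed.

Lemma momentumE k (q : R -> 'cV[R]_n) s : Omega (q s) ->
  momentum h uhat k q s = (canonical_momentum k (q s))%:C.
Proof.
move=> Oq; have [[_ e1] [_ e2]] := reduced_lagrangian_velocity k (derive1 q s) Oq.
exact: (congr2 (@Complex R) e1 e2).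
Qed.

(** * The Euler-Lagrange equations *)

(** The k-th row of the imaginary part of the master equation, with
    Im (- i z) = - Re z already used for xi and eta. *)
Definition Im_residual (q v : 'cV[R]_n) (k : 'I_n) : R :=
  \sum_j complex.Im (metric uhat q k j) * v j 0
  + (complex.Re (cint (fun x => dq k uhat q x * hu q x))
     + complex.Re (cint (fun x => dq k (uhat_x uhat) q x * hux q x))).

Lemma master_Im_residual q v : Omega q ->
  master_Im h uhat q v <-> forall k, Im_residual q v k = 0.
Proof.
move=> Oq; have E k : Im_residual q v k =
    (Immx (metric uhat q) *m v) k 0 - (Immx (xi h uhat q) + Immx (eta h uhat q)) k 0.
  apply: (etrans _ (esym (Im_system_coord _ _ _ _ _))).
  have eX := etrans (congr1 (@complex.Im R) (xi_coord q k)) (Im_mulNi _).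
  have eY := etrans (congr1 (@complex.Im R) (eta_coord q k)) (Im_mulNi _).
  pose S := \sum_j complex.Im (metric uhat q k j) * v j 0.
  apply: (etrans _ (esym (congr2 (fun a b => S - (a + b)) eX eY))).
  by rewrite -opprD opprK.
split=> [H k|H]; first by rewrite E H subrr.
by apply/colP => k; apply/eqP; rewrite -subr_eq0 -E H.
Qed.

Lemma euler_lagrange_residual (q v : 'cV[R]_n) k : Omega q ->
  ((\sum_j v j 0 * \int[mu]_x 'D_(Defs.basis k) ((momentum_density j) ^~ x) q
    + complex.Re ((complex.Re (cint (fun x => dq k uhat q x * hu q x))
   + complex.Re (cint (fun x => dq k (uhat_x uhat) q x * hux q x))) * 2)%:C)
   +i* complex.Im ((complex.Re (cint (fun x => dq k uhat q x * hu q x))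
   + complex.Re (cint (fun x => dq k (uhat_x uhat) q x * hux q x))) * 2)%:C)
  - ((\sum_j v j 0 *
       \int[mu]_x 'D_(Defs.basis j) ((momentum_density k) ^~ x) q) +i* 0) =
  (2 * Im_residual q v k)%:C.
Proof.
move=> Oq.
have E : \sum_j v j 0 * \int[mu]_x 'D_(Defs.basis k) ((momentum_density j) ^~ x) q
  - \sum_j v j 0 * \int[mu]_x 'D_(Defs.basis j) ((momentum_density k) ^~ x) q
  = 2 * \sum_j complex.Im (metric uhat q k j) * v j 0.
  rewrite -sumrB mulr_sumr; apply: eq_bigr => j _.
  by rewrite -mulrBr curl_canonical_momentum// mulrCA (mulrC (v j 0)).
exact: (EL_algebra _ E).
Qed.

(** The Euler-Lagrange expression is twice Im_residual; the derivatives that the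
    equations presuppose exist for every trajectory. *)
Lemma master_Im_euler_lagrange (q : R -> 'cV[R]_n) (t : R) :
  (\forall s \near t, Omega (q s) /\ derivable q s 1) ->
  master_Im h uhat (q t) (derive1 q t) <-> reduced_euler_lagrange h uhat q t.
Proof.
move=> near_t; have [Oq dq_t] := nbhs_singleton near_t.
set v := derive1 q t; set q0 := q t.
have vE : 'D_1 q t = v by rewrite /v derive1E.
have dmom k : is_derive t 1 (fun s => canonical_momentum k (q s)) (\sum_j v j 0 *
    \int[mu]_x 'D_(Defs.basis j) ((momentum_density k) ^~ x) q0).
  by rewrite -vE; exact: canonical_momentum_derive.
have dRm k : is_derive t 1 (fun s => complex.Re (momentum h uhat k q s))
    (\sum_j v j 0 * \int[mu]_x 'D_(Defs.basis j) ((momentum_density k) ^~ x) q0).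
  apply: near_eq_is_derive (dmom k); apply: filterS near_t => s [Os _].
  by rewrite momentumE.
have dIm k : is_derive t 1 (fun s => complex.Im (momentum h uhat k q s)) 0.
  apply: near_eq_is_derive (is_derive_cst (0 : R) t 1).
  by apply: filterS near_t => s [Os _]; rewrite momentumE.
pose EL k := cD (Defs.basis k) (fun p => reduced_lagrangian h uhat p v) q0
  - dd (momentum h uhat k q) t.
have ELE k : EL k = (2 * Im_residual q0 v k)%:C.
  have [[_ e1] [_ e2]] := reduced_lagrangian_position k v Oq.
  have [_ e3] := dRm k; have [_ e4] := dIm k.
  have cDE := congr2 (@Complex R) e1 e2.
  have ddE := congr2 (@Complex R) e3 e4.
  apply: (etrans (congr2 (fun a b => a - b) cDE ddE)).
  rewrite cint_dq_h_along//; exact: euler_lagrange_residual.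
split=> [/(master_Im_residual _ Oq) H k|H].
  have [[dL1 _] [dL2 _]] := reduced_lagrangian_position k v Oq.
  have [dm1 _] := dRm k; have [dm2 _] := dIm k.
  split.
  - exact: (conj dL1 dL2).
  - apply: filterS near_t => s [Os _].
    have [[d1 _] [d2 _]] := reduced_lagrangian_velocity k (derive1 q s) Os.
    exact: (conj d1 d2).
  - exact: (conj dm1 dm2).
  - by apply: (etrans (ELE k)); rewrite H mulr0.
apply/(master_Im_residual _ Oq) => k; have [_ _ _ H0] := H k.
have := congr1 (@complex.Re R) (etrans (esym (ELE k)) H0).
by move=> /eqP; rewrite mulf_eq0 pnatr_eq0 /= => /eqP.
Qed.

End Ansatz.

Theorem theorem1 (R : realType) (n : nat)
    (h : R[i] -> R[i] -> R[i])
    (h_C2 : C2_map h)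
    (h_conj : forall u p, (h_u h u p)^* = h_ubar h u p)
    (h_pde : first_variation_leads_to_pde h)
    (Omega : set 'cV[R]_n) (Omega_open : open Omega)
    (uhat : 'cV[R]_n -> R -> R[i])
    (uhat_smooth : sufficiently_smooth h uhat Omega)
    (M_posdef : forall q, Omega q -> hermitian_posdef (metric uhat q)) :
  (forall q v : 'cV[R]_n, Omega q ->
     (master_Re h uhat q v <-> rons_minimizer h uhat q v) /\
     (master_Re h uhat q v <-> rons_equation h uhat q v))
  /\
  (forall (q : R -> 'cV[R]_n) (t : R),
     (\forall s \near t, Omega (q s) /\ derivable q s 1) ->
     (master_Im h uhat (q t) (derive1 q t) <-> reduced_euler_lagrange h uhat q t)).
Proof.
split=> [q v Oq|q t near_t].
  split; first exact: (master_Re_minimizer h_C2 h_conj h_pde Omega_open uhat_smooth).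
  exact: (master_Re_equation h_C2 h_conj h_pde Omega_open uhat_smooth v Oq
    (M_posdef q Oq)).
exact: (master_Im_euler_lagrange h_C2 h_conj h_pde Omega_open uhat_smooth near_t).
Qed.
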